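(* (i) Let $\Psi:\mathbb{D}\to\mathbb{C}$ and $\phi:\mathbb{D}\to\mathbb{D}$ be holomorphic maps such that the weighted composition operator $W_{\Psi,\phi}:\mathcal{H}^2_2(\mathbb{D})\to\mathcal{H}^2_2(\mathbb{D})$ is complex symmetric with conjugation $\mathcal{J}$. Then for all $z\in\mathbb{D}$, $$\phi(z)=a_0+a_1\frac{q(z)}{p(z)},\qquad \Psi(z)=a_2\,p(z),$$ where $a_0=\phi(0)$, $a_1=\phi'(0)$, $a_2=3888\,\Psi(0)$, and $$p(z)=\frac{2}{243}\sum_{n=0}^{\infty}\frac{n+1}{(n+2)^5}a_0^nz^n,\qquad q(z)=\frac{1}{32}\sum_{n=1}^{\infty}\frac{n(n+1)}{(n+2)^5}a_0^{n-1}z^n.$$ (ii) Conversely, let $a_0,a_1\in\mathbb{D}$ and $a_2\in\mathbb{C}$, and let $p$ and $q$ be defined from $a_0$ by the two formulas in (i). Suppose $\phi(z)=a_0+a_1\frac{q(z)}{p(z)}$ and $\Psi(z)=a_2p(z)$ are holomorphic maps on $\mathbb{D}$, with $\phi(\mathbb{D})\subseteq\mathbb{D}$. Then the weighted composition operator $W_{\Psi,\phi}:\mathcal{H}^2_2(\mathbb{D})\to\mathcal{H}^2_2(\mathbb{D})$ is complex symmetric with conjugation $\mathcal{J}$ only if $a_0=0$ or $a_1=0$ (or both are zero).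
   Context: $\mathbb{D}$ is the open unit disk in $\mathbb{C}$ and $H(\mathbb{D})$ is the space of holomorphic functions on $\mathbb{D}$. $\mathcal{H}^2_2(\mathbb{D})$ is the Hilbert space of all $f(z)=\sum_{n\ge0}a_nz^n\in H(\mathbb{D})$ with $\|f\|^2_{\mathcal{H}^2_2}=\sum_{n\ge0}\frac{(n+2)^5}{n+1}|a_n|^2<\infty$, with inner product $\langle \sum a_nz^n,\sum b_nz^n\rangle_{\mathcal{H}^2_2}=\sum_{n\ge0}\frac{(n+2)^5}{n+1}a_n\overline{b_n}$. Its reproducing kernel at $w\in\mathbb{D}$ is $K_w(z)=\sum_{n\ge0}\frac{n+1}{(n+2)^5}(\overline{w}z)^n$. For holomorphic $\Psi:\mathbb{D}\to\mathbb{C}$ and $\phi:\mathbb{D}\to\mathbb{D}$, $W_{\Psi,\phi}f=\Psi\cdot(f\circ\phi)$. A conjugation on a complex Hilbert space $\mathcal{H}$ is an antilinear map $\mathcal{C}:\mathcal{H}\to\mathcal{H}$ with $\mathcal{C}^2=I$ and $\langle\mathcal{C}x,\mathcal{C}y\rangle=\langle y,x\rangle$ for all $x,y\in\mathcal{H}$. A bounded linear operator $T$ on $\mathcal{H}$ is complex symmetric with conjugation $\mathcal{C}$ if $T\mathcal{C}=\mathcal{C}T^*$. $\mathcal{J}$ is the conjugation on $\mathcal{H}^2_2(\mathbb{D})$ given by $(\mathcal{J}f)(z)=\overline{f(\overline{z})}$, so that $\mathcal{J}K_w=K_{\overline{w}}$. Convention: $0^0=1$.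
   Formalization: The zero operator is excluded, where the claim fails: in (i) the formula for φ is asserted only when Ψ is not identically zero (e.g. Ψ=0, φ(z)=z² violates it), the formula for Ψ always; in (ii) a₂≠0 is assumed, since a₂=0 gives W=0, symmetric even for small nonzero a₀, a₁. *)

(* Defs.v *)
From Stdlib Require Import Reals Lra Lia Psatz ProofIrrelevance FunctionalExtensionality.
From Coquelicot Require Export Coquelicot.

Local Open Scope R_scope.

(** * Complex Hilbert spaces and complex symmetric operators *)

(** The inner product is linear in the first variable.  Completeness is
    stated for the norm [sqrt <x, x>], with the squares cleared. *)
Record HilbertSpace := {
  hs_space :> ModuleSpace C_Ring;
  inner : hs_space -> hs_space -> C;
  inner_plus_l : forall x y z, inner (plus x y) z = (inner x z + inner y z)%C;
  inner_scal_l : forall (c : C) x y, inner (scal c x) y = (c * inner x y)%C;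
  inner_conj : forall x y, inner y x = Cconj (inner x y);
  inner_ge_0 : forall x, 0 <= Re (inner x x);
  inner_eq_0 : forall x, inner x x = 0%C -> x = zero;
  inner_complete : forall u : nat -> hs_space,
    (forall eps : R, 0 < eps -> exists N : nat, forall m n : nat,
        (N <= m)%nat -> (N <= n)%nat ->
        Re (inner (minus (u m) (u n)) (minus (u m) (u n))) <= eps) ->
    exists x, forall eps : R, 0 < eps -> exists N : nat, forall n : nat,
        (N <= n)%nat ->
        Re (inner (minus (u n) x) (minus (u n) x)) <= eps
}.

Arguments inner {h} _ _.

Definition hnorm {H : HilbertSpace} (x : H) : R := sqrt (Re (inner x x)).

Definition bounded_linear {H : HilbertSpace} (T : H -> H) : Prop :=
  (forall x y, T (plus x y) = plus (T x) (T y)) /\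
  (forall (c : C) x, T (scal c x) = scal c (T x)) /\
  (exists M : R, forall x, hnorm (T x) <= M * hnorm x).

Definition is_adjoint {H : HilbertSpace} (T S : H -> H) : Prop :=
  forall x y, inner (T x) y = inner x (S y).

Record conjugation (H : HilbertSpace) := {
  conj_map :> H -> H;
  conj_map_plus :
    forall x y, conj_map (plus x y) = plus (conj_map x) (conj_map y);
  conj_map_scal :
    forall (c : C) x, conj_map (scal c x) = scal (Cconj c) (conj_map x);
  conj_map_invol : forall x, conj_map (conj_map x) = x;
  conj_map_inner : forall x y, inner (conj_map x) (conj_map y) = inner y x
}.

Definition complex_symmetric {H : HilbertSpace} (T : H -> H)
    (C : conjugation H) : Prop :=
  bounded_linear T /\
  exists Tstar : H -> H, is_adjoint T Tstar /\
    forall x, T (C x) = C (Tstar x).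

(** * Complex series *)

Definition CSeries (a : nat -> C) : C :=
  (Series (fun n => Re (a n)), Series (fun n => Im (a n))).

Lemma ex_series_scal_R (c : R) (a : nat -> R) :
  ex_series a -> ex_series (fun n => c * a n).
Proof. exact (ex_series_scal_l (K := R_AbsRing) (V := R_NormedModule) c a). Qed.

Lemma sum_n_C (a : nat -> C) (n : nat) :
  sum_n (G := C_R_NormedModule) a n =
  (sum_n (fun n => Re (a n)) n, sum_n (fun n => Im (a n)) n).
Proof.
induction n as [|n IH].
- rewrite !sum_O. now destruct (a 0%nat).
- rewrite !sum_Sn, IH. now destruct (a (S n)).
Qed.

Lemma CSeries_correct (a : nat -> C) :
  ex_series (fun n => Cmod (a n)) ->
  is_series (V := C_R_NormedModule) a (CSeries a).
Proof.
intros H.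
assert (HR : is_series (fun n => Re (a n)) (Series (fun n => Re (a n)))).
{ apply Series_correct, (@ex_series_le R_AbsRing R_CompleteNormedModule _
    (fun n => Cmod (a n))); trivial.
  intros n. apply re_le_Cmod. }
assert (HI : is_series (fun n => Im (a n)) (Series (fun n => Im (a n)))).
{ apply Series_correct, (@ex_series_le R_AbsRing R_CompleteNormedModule _
    (fun n => Cmod (a n))); trivial.
  intros n. eapply Rle_trans; [ | apply Rmax_Cmod]. apply Rmax_r. }
assert (E := sum_n_C a).
unfold is_series in *.
apply filterlim_ext with (f := fun n =>
   (sum_n (fun n => Re (a n)) n, sum_n (fun n => Im (a n)) n)).
{ intros n. symmetry. apply E. }
intros P [eps HP].
destruct (HR _ (locally_ball _ eps)) as [N1 H1].
destruct (HI _ (locally_ball _ eps)) as [N2 H2].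
exists (Nat.max N1 N2). intros n Hn. apply HP.
split; [apply (H1 n) | apply (H2 n)]; lia.
Qed.

(** * The unit disk and holomorphic functions *)

Definition disk (z : C) : Prop := Cmod z < 1.

Definition holomorphic_on_disk (f : C -> C) : Prop :=
  forall z : C, disk z -> ex_derive (K := C_AbsRing) (V := C_NormedModule) f z.

(** * The space H^2_2(D) *)

Definition weight (n : nat) : R := (INR n + 2) ^ 5 / (INR n + 1).

(** An element is given by its Taylor coefficients at 0.  Since [1 <= weight n],
    the summability condition makes the power series converge on the disk
    ([H22_eval_correct]), so it defines an element of H(D). *)
Record H22 := mkH22 {
  coef : nat -> C;
  coef_summable : ex_series (fun n => weight n * Cmod (coef n) ^ 2)
}.

Definition H22_eval (f : H22) (z : C) : C :=
  CSeries (fun n => coef f n * z ^ n)%C.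

Definition H22_inner (f g : H22) : C :=
  CSeries (fun n => weight n * coef f n * Cconj (coef g n))%C.

Lemma weight_ge_1 n : 1 <= weight n.
Proof.
unfold weight. assert (H := pos_INR n).
apply Rmult_le_reg_r with (INR n + 1); [lra|].
unfold Rdiv. rewrite Rmult_assoc, Rinv_l by lra.
assert (1 <= (INR n + 2) ^ 4) by (apply pow_R1_Rle; lra).
simpl in *. nra.
Qed.

Lemma H22_ext (f g : H22) : (forall n, coef f n = coef g n) -> f = g.
Proof.
destruct f as [a Ha], g as [b Hb]; simpl; intros E.
assert (a = b) by now apply functional_extensionality.
subst b. f_equal. apply proof_irrelevance.
Qed.

Lemma H22_eval_abs (f : H22) (z : C) :
  disk z -> ex_series (fun n => Cmod (coef f n * z ^ n)%C).
Proof.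
unfold disk. intros Hz. assert (Hm := Cmod_ge_0 z).
apply (@ex_series_le R_AbsRing R_CompleteNormedModule _
  (fun n => weight n * Cmod (coef f n) ^ 2 + Cmod z ^ n)).
- intros n. change (Rabs (Cmod (coef f n * z ^ n)%C) <=
     weight n * Cmod (coef f n) ^ 2 + Cmod z ^ n).
  rewrite Rabs_pos_eq by apply Cmod_ge_0.
  rewrite Cmod_mult, Cmod_pow.
  assert (H1 := weight_ge_1 n). assert (H2 := Cmod_ge_0 (coef f n)).
  assert (H3 : 0 <= Cmod z ^ n) by now apply pow_le.
  assert (H4 : Cmod z ^ n <= 1).
  { rewrite <- (pow1 n). apply pow_incr. lra. }
  set (t := Cmod (coef f n)) in *. set (s := Cmod z ^ n) in *.
  assert (t ^ 2 <= weight n * t ^ 2) by (assert (0 <= t ^ 2) by nra; nra).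
  assert (t * s <= t ^ 2 + s ^ 2)
    by (assert (0 <= (t - s) ^ 2) by apply pow2_ge_0; nra).
  nra.
- apply (ex_series_plus (V := R_NormedModule)); [apply coef_summable|].
  apply ex_series_geom. now rewrite Rabs_pos_eq.
Qed.

Lemma H22_eval_correct (f : H22) (z : C) :
  disk z ->
  is_series (V := C_R_NormedModule) (fun n => coef f n * z ^ n)%C
    (H22_eval f z).
Proof. intros Hz. now apply CSeries_correct, H22_eval_abs. Qed.

Lemma H22_plus_summable (f g : H22) :
  ex_series (fun n => weight n * Cmod (coef f n + coef g n)%C ^ 2).
Proof.
apply (@ex_series_le R_AbsRing R_CompleteNormedModule _
  (fun n => 2 * (weight n * Cmod (coef f n) ^ 2)
            + 2 * (weight n * Cmod (coef g n) ^ 2))).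
- intros n. assert (H1 := weight_ge_1 n).
  change (Rabs (weight n * Cmod (coef f n + coef g n)%C ^ 2) <=
    2 * (weight n * Cmod (coef f n) ^ 2) + 2 * (weight n * Cmod (coef g n) ^ 2)).
  rewrite Rabs_pos_eq by (apply Rmult_le_pos; [lra|apply pow2_ge_0]).
  rewrite !Cmod2_alt, re_plus, im_plus.
  set (w := weight n) in *.
  set (a := Re (coef f n)). set (b := Im (coef f n)).
  set (c := Re (coef g n)). set (d := Im (coef g n)).
  assert (0 <= w * ((a - c) ^ 2 + (b - d) ^ 2)).
  { apply Rmult_le_pos; [lra|]. generalize (pow2_ge_0 (a-c)) (pow2_ge_0 (b-d)). lra. }
  nra.
- apply (ex_series_plus (V := R_NormedModule));
    apply ex_series_scal_R; apply coef_summable.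
Qed.

Lemma H22_scal_summable (c : C) (f : H22) :
  ex_series (fun n => weight n * Cmod (c * coef f n)%C ^ 2).
Proof.
apply ex_series_ext with (fun n => Cmod c ^ 2 * (weight n * Cmod (coef f n) ^ 2)).
- intros n. rewrite Cmod_mult, Rpow_mult_distr.
  change (Cmod c ^ 2 * (weight n * Cmod (coef f n) ^ 2) =
    weight n * (Cmod c ^ 2 * Cmod (coef f n) ^ 2)). ring.
- apply ex_series_scal_R, coef_summable.
Qed.

Lemma H22_zero_summable : ex_series (fun n => weight n * Cmod (RtoC 0) ^ 2).
Proof.
apply ex_series_ext with (fun n => 0 * (/ 2) ^ n).
- intros n. rewrite Cmod_0. symmetry. change (weight n * 0 ^ 2 = 0 * (/ 2) ^ n). ring.
- apply ex_series_scal_R, ex_series_geom. rewrite Rabs_pos_eq; lra.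
Qed.

Lemma H22_conj_summable (f : H22) :
  ex_series (fun n => weight n * Cmod (Cconj (coef f n)) ^ 2).
Proof.
apply ex_series_ext with (fun n => weight n * Cmod (coef f n) ^ 2).
- intros n. now rewrite Cmod_conj.
- apply coef_summable.
Qed.

Definition H22_plus (f g : H22) : H22 :=
  mkH22 (fun n => coef f n + coef g n)%C (H22_plus_summable f g).
Definition H22_scal (c : C) (f : H22) : H22 :=
  mkH22 (fun n => c * coef f n)%C (H22_scal_summable c f).
Definition H22_opp (f : H22) : H22 := H22_scal (-(1))%C f.
Definition H22_zero : H22 := mkH22 (fun _ => RtoC 0) H22_zero_summable.

Lemma H22_plus_comm f g : H22_plus f g = H22_plus g f.
Proof. apply H22_ext; intros n; simpl; ring. Qed.
Lemma H22_plus_assoc f g h :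
  H22_plus f (H22_plus g h) = H22_plus (H22_plus f g) h.
Proof. apply H22_ext; intros n; simpl; ring. Qed.
Lemma H22_plus_zero f : H22_plus f H22_zero = f.
Proof. apply H22_ext; intros n; simpl; ring. Qed.
Lemma H22_plus_opp f : H22_plus f (H22_opp f) = H22_zero.
Proof. apply H22_ext; intros n; simpl; ring. Qed.

Definition H22_AbelianMonoid_mixin :=
  AbelianMonoid.Mixin H22 H22_plus H22_zero
    H22_plus_comm H22_plus_assoc H22_plus_zero.
Canonical H22_AbelianMonoid := AbelianMonoid.Pack H22 H22_AbelianMonoid_mixin H22.
Definition H22_AbelianGroup_mixin :=
  AbelianGroup.Mixin H22_AbelianMonoid H22_opp H22_plus_opp.
Canonical H22_AbelianGroup :=
  AbelianGroup.Pack H22 (AbelianGroup.Class H22 _ H22_AbelianGroup_mixin) H22.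

Lemma H22_scal_assoc (c d : C_Ring) (f : H22_AbelianGroup) :
  H22_scal c (H22_scal d f) = H22_scal (mult c d) f.
Proof.
apply H22_ext; intros n. change (c * (d * coef f n) = c * d * coef f n)%C. ring.
Qed.
Lemma H22_scal_one (f : H22_AbelianGroup) :
  H22_scal (one : C_Ring) f = f.
Proof. apply H22_ext; intros n. change (1 * coef f n = coef f n)%C. ring. Qed.
Lemma H22_scal_plus_r (c : C_Ring) (f g : H22_AbelianGroup) :
  H22_scal c (plus f g) = plus (H22_scal c f : H22_AbelianGroup) (H22_scal c g).
Proof.
apply H22_ext; intros n.
change (c * (coef f n + coef g n) = c * coef f n + c * coef g n)%C. ring.
Qed.
Lemma H22_scal_plus_l (c d : C_Ring) (f : H22_AbelianGroup) :
  H22_scal (plus c d) f = plus (H22_scal c f : H22_AbelianGroup) (H22_scal d f).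
Proof.
apply H22_ext; intros n.
change ((c + d) * coef f n = c * coef f n + d * coef f n)%C. ring.
Qed.

Definition H22_ModuleSpace_mixin :=
  ModuleSpace.Mixin C_Ring H22_AbelianGroup H22_scal
    H22_scal_assoc H22_scal_one H22_scal_plus_r H22_scal_plus_l.
Canonical H22_ModuleSpace : ModuleSpace C_Ring :=
  ModuleSpace.Pack C_Ring H22
    (ModuleSpace.Class C_Ring H22 _ H22_ModuleSpace_mixin) H22.

Lemma H22_inner_abs (f g : H22) :
  ex_series (fun n => Cmod (weight n * coef f n * Cconj (coef g n))%C).
Proof.
apply (@ex_series_le R_AbsRing R_CompleteNormedModule _
  (fun n => weight n * Cmod (coef f n) ^ 2 + weight n * Cmod (coef g n) ^ 2)).
- intros n. assert (H1 := weight_ge_1 n).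
  change (Rabs (Cmod (weight n * coef f n * Cconj (coef g n))%C) <=
    weight n * Cmod (coef f n) ^ 2 + weight n * Cmod (coef g n) ^ 2).
  rewrite Rabs_pos_eq by apply Cmod_ge_0.
  rewrite !Cmod_mult, Cmod_conj, Cmod_R, Rabs_pos_eq by lra.
  set (s := Cmod (coef f n)). set (t := Cmod (coef g n)).
  assert (s * t <= s ^ 2 + t ^ 2).
  { generalize (pow2_ge_0 (s - t)) (pow2_ge_0 s) (pow2_ge_0 t). nra. }
  nra.
- apply (ex_series_plus (V := R_NormedModule)); apply coef_summable.
Qed.

Lemma CSeries_unique (a : nat -> C) (l : C) :
  is_series (V := C_R_NormedModule) a l -> CSeries a = l.
Proof.
intros H.
unfold CSeries. apply injective_projections; simpl; apply is_series_unique;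
  intros P [eps HP]; destruct (H _ (locally_ball _ eps)) as [N HN];
  exists N; intros n Hn; apply HP;
  clear HP.
all: assert (Hb : ball (M := C_R_NormedModule) l eps
    (sum_n (G := C_R_NormedModule) a n)) by exact (HN n Hn);
  rewrite sum_n_C in Hb; apply Hb.
Qed.

Lemma CSeries_ext (a b : nat -> C) :
  (forall n, a n = b n) -> CSeries a = CSeries b.
Proof.
intros E. unfold CSeries. f_equal; apply Series_ext; intros n; now rewrite E.
Qed.

Lemma CSeries_plus (a b : nat -> C) :
  ex_series (fun n => Cmod (a n)) -> ex_series (fun n => Cmod (b n)) ->
  CSeries (fun n => a n + b n)%C = (CSeries a + CSeries b)%C.
Proof.
intros Ha Hb. apply CSeries_unique.
exact (is_series_plus (V := C_R_NormedModule) _ _ _ _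
  (CSeries_correct _ Ha) (CSeries_correct _ Hb)).
Qed.

Lemma CSeries_re_im (a : nat -> C) :
  ex_series (fun n => Cmod (a n)) ->
  ex_series (fun n => Re (a n)) /\ ex_series (fun n => Im (a n)).
Proof.
intros H. split; apply (@ex_series_le R_AbsRing R_CompleteNormedModule _
    (fun n => Cmod (a n))); trivial; intros n.
- apply re_le_Cmod.
- eapply Rle_trans; [ | apply Rmax_Cmod]. apply Rmax_r.
Qed.

Lemma CSeries_scal (c : C) (a : nat -> C) :
  ex_series (fun n => Cmod (a n)) ->
  CSeries (fun n => c * a n)%C = (c * CSeries a)%C.
Proof.
intros H. destruct (CSeries_re_im _ H) as [HR HI].
unfold CSeries.
assert (E1 : Series (fun n => Re (c * a n)%C) =
  Re c * Series (fun n => Re (a n)) - Im c * Series (fun n => Im (a n))).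
{ rewrite <- !Series_scal_l, <- Series_minus.
  - apply Series_ext; intros n. apply re_mult.
  - now apply ex_series_scal_R.
  - now apply ex_series_scal_R. }
assert (E2 : Series (fun n => Im (c * a n)%C) =
  Re c * Series (fun n => Im (a n)) + Im c * Series (fun n => Re (a n))).
{ rewrite <- !Series_scal_l, <- Series_plus.
  - apply Series_ext; intros n. apply im_mult.
  - now apply ex_series_scal_R.
  - now apply ex_series_scal_R. }
rewrite E1, E2. destruct c; reflexivity.
Qed.

Lemma CSeries_conj (a : nat -> C) :
  CSeries (fun n => Cconj (a n)) = Cconj (CSeries a).
Proof.
unfold CSeries, Cconj; simpl. f_equal. rewrite <- Series_opp.
now apply Series_ext.
Qed.

Lemma H22_inner_plus_l (f g h : H22) :
  H22_inner (H22_plus f g) h = (H22_inner f h + H22_inner g h)%C.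
Proof.
unfold H22_inner. rewrite <- CSeries_plus by apply H22_inner_abs.
apply CSeries_ext; intros n; simpl. ring.
Qed.

Lemma H22_inner_scal_l (c : C) (f g : H22) :
  H22_inner (H22_scal c f) g = (c * H22_inner f g)%C.
Proof.
unfold H22_inner. rewrite <- CSeries_scal by apply H22_inner_abs.
apply CSeries_ext; intros n; simpl. ring.
Qed.

Lemma Cconj_R (r : R) : Cconj r = r.
Proof. unfold Cconj, RtoC; simpl. now rewrite Ropp_0. Qed.

Lemma H22_inner_conj (f g : H22) : H22_inner g f = Cconj (H22_inner f g).
Proof.
unfold H22_inner. rewrite <- CSeries_conj.
apply CSeries_ext; intros n.
rewrite !Cmult_conj, Cconj_conj, Cconj_R. ring.
Qed.

Lemma H22_inner_self (f : H22) :
  H22_inner f f = Series (fun n => weight n * Cmod (coef f n) ^ 2).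
Proof.
assert (E : forall n, (weight n * coef f n * Cconj (coef f n))%C
   = RtoC (weight n * Cmod (coef f n) ^ 2)).
{ intros n. rewrite RtoC_mult, Cmod2_conj. ring. }
unfold H22_inner. rewrite (CSeries_ext _ _ E).
unfold CSeries, RtoC; simpl. f_equal.
rewrite <- (Series_ext (fun n => 0 * 0)) by (intros; ring).
rewrite Series_scal_l. ring.
Qed.

Lemma H22_inner_self_re (f : H22) :
  Re (H22_inner f f) = Series (fun n => weight n * Cmod (coef f n) ^ 2).
Proof. now rewrite H22_inner_self. Qed.

Lemma weight_sq_ge_0 n (a : C) : 0 <= weight n * Cmod a ^ 2.
Proof.
generalize (weight_ge_1 n) (pow2_ge_0 (Cmod a)). intros; nra.
Qed.

Lemma H22_inner_ge_0 (f : H22) : 0 <= Re (H22_inner f f).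
Proof.
rewrite H22_inner_self_re.
replace 0 with (Series (fun n => 0 * 0)) by (rewrite Series_scal_l; ring).
apply Series_le; [ | apply coef_summable].
intros n. rewrite Rmult_0_l. split; [lra|apply weight_sq_ge_0].
Qed.

Lemma sum_n_le_Series (a : nat -> R) (n : nat) :
  (forall k, 0 <= a k) -> ex_series a -> sum_n a n <= Series a.
Proof.
intros Ha Hs.
apply (is_lim_seq_incr_compare (sum_n a)).
- exact (Series_correct _ Hs).
- intros k. rewrite sum_Sn. unfold plus; simpl. generalize (Ha (S k)). lra.
Qed.

Lemma term_le_sum_n (a : nat -> R) (n : nat) :
  (forall k, 0 <= a k) -> 0 <= sum_n a n /\ a n <= sum_n a n.
Proof.
intros Ha. induction n as [|n IH].
- rewrite sum_O. split; [apply Ha|lra].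
- rewrite sum_Sn. unfold plus; simpl. generalize (Ha (S n)). lra.
Qed.

Lemma H22_term_le (f : H22) (n : nat) :
  Cmod (coef f n) ^ 2 <= Re (H22_inner f f).
Proof.
rewrite H22_inner_self_re.
set (a := fun n => weight n * Cmod (coef f n) ^ 2).
assert (Ha : forall k, 0 <= a k) by (intros k; apply weight_sq_ge_0).
apply Rle_trans with (a n).
- unfold a. generalize (weight_ge_1 n) (pow2_ge_0 (Cmod (coef f n))).
  intros; nra.
- apply Rle_trans with (sum_n a n); [now apply term_le_sum_n|].
  apply sum_n_le_Series; trivial. apply coef_summable.
Qed.

Lemma H22_inner_eq_0 (f : H22) : H22_inner f f = 0%C -> f = H22_zero.
Proof.
intros H. apply H22_ext; intros n; simpl.
apply Cmod_eq_0. assert (Ht := H22_term_le f n).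
rewrite H in Ht; simpl Re in Ht. generalize (Cmod_ge_0 (coef f n)).
intros. nra.
Qed.

Lemma ex_series_bounded (a : nat -> R) (M : R) :
  (forall k, 0 <= a k) -> (forall n, sum_n a n <= M) ->
  ex_series a /\ Series a <= M.
Proof.
intros Ha HM.
assert (E : ex_finite_lim_seq (sum_n a)).
{ apply ex_finite_lim_seq_incr with M; trivial.
  intros k. rewrite sum_Sn. unfold plus; simpl. generalize (Ha (S k)). lra. }
destruct E as [l Hl].
split; [now exists l|].
rewrite (is_series_unique a l Hl).
exact (is_lim_seq_le _ _ l M HM Hl (is_lim_seq_const M)).
Qed.

Definition H22_minus (f g : H22) : H22 := H22_plus f (H22_opp g).

Lemma coef_minus f g n : coef (H22_minus f g) n = (coef f n - coef g n)%C.
Proof. simpl. ring. Qed.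

Lemma real_cauchy_lim (v : nat -> R) :
  (forall eps : R, 0 < eps -> exists N : nat, forall m n : nat,
     (N <= m)%nat -> (N <= n)%nat -> (v m - v n) ^ 2 <= eps) ->
  exists l : R, is_lim_seq v l.
Proof.
intros H.
assert (E : ex_finite_lim_seq v); [ | exact E].
apply ex_lim_seq_cauchy_corr. intros eps.
assert (He := cond_pos eps).
destruct (H ((eps / 2) ^ 2)) as [N HN]; [nra|].
exists N. intros n m Hn Hm.
apply Rle_lt_trans with (eps / 2); [ | lra].
apply Rsqr_incr_0_var; [ | lra].
rewrite <- Rsqr_abs, !Rsqr_pow2. now apply HN.
Qed.

Lemma H22_inner_complete (u : nat -> H22) :
  (forall eps : R, 0 < eps -> exists N : nat, forall m n : nat,
      (N <= m)%nat -> (N <= n)%nat ->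
      Re (H22_inner (H22_minus (u m) (u n)) (H22_minus (u m) (u n))) <= eps) ->
  exists x, forall eps : R, 0 < eps -> exists N : nat, forall n : nat,
      (N <= n)%nat ->
      Re (H22_inner (H22_minus (u n) x) (H22_minus (u n) x)) <= eps.
Proof.
intros H.
assert (HR : forall k, exists l : R, is_lim_seq (fun m => Re (coef (u m) k)) l).
{ intros k. apply real_cauchy_lim. intros eps He.
  destruct (H eps He) as [N HN]. exists N. intros m n Hm Hn.
  eapply Rle_trans; [ | apply (HN m n Hm Hn)].
  eapply Rle_trans; [ | apply (H22_term_le _ k)].
  rewrite coef_minus, Cmod2_alt. unfold Cminus.
  rewrite re_plus, re_opp, im_plus, im_opp.
  match goal with |- _ <= _ + ?t ^ 2 => generalize (pow2_ge_0 t) end.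
  unfold Rminus. lra. }
assert (HI : forall k, exists l : R, is_lim_seq (fun m => Im (coef (u m) k)) l).
{ intros k. apply real_cauchy_lim. intros eps He.
  destruct (H eps He) as [N HN]. exists N. intros m n Hm Hn.
  eapply Rle_trans; [ | apply (HN m n Hm Hn)].
  eapply Rle_trans; [ | apply (H22_term_le _ k)].
  rewrite coef_minus, Cmod2_alt. unfold Cminus.
  rewrite re_plus, re_opp, im_plus, im_opp.
  match goal with |- _ <= ?t ^ 2 + _ => generalize (pow2_ge_0 t) end.
  unfold Rminus. lra. }
set (a := fun k => (real (Lim_seq (fun m => Re (coef (u m) k))),
                    real (Lim_seq (fun m => Im (coef (u m) k)))) : C).
assert (HaR : forall k, is_lim_seq (fun m => Re (coef (u m) k)) (Re (a k))).
{ intros k. destruct (HR k) as [l Hl]. unfold a; simpl.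
  now rewrite (is_lim_seq_unique _ _ Hl). }
assert (HaI : forall k, is_lim_seq (fun m => Im (coef (u m) k)) (Im (a k))).
{ intros k. destruct (HI k) as [l Hl]. unfold a; simpl.
  now rewrite (is_lim_seq_unique _ _ Hl). }
assert (Hlim : forall n k, is_lim_seq
   (fun m => weight k * Cmod (coef (u n) k - coef (u m) k)%C ^ 2)
   (weight k * Cmod (coef (u n) k - a k)%C ^ 2)).
{ intros n k.
  apply (is_lim_seq_scal_l _ (weight k)
    (Finite (Cmod (coef (u n) k - a k)%C ^ 2))).
  assert (E : forall z : C, Cmod (coef (u n) k - z)%C ^ 2 =
     (Re (coef (u n) k) - Re z) * (Re (coef (u n) k) - Re z) +
     (Im (coef (u n) k) - Im z) * (Im (coef (u n) k) - Im z)).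
  { intros z. rewrite Cmod2_alt. unfold Cminus.
    rewrite re_plus, re_opp, im_plus, im_opp. ring. }
  rewrite E.
  eapply is_lim_seq_ext; [intros m; symmetry; apply E|].
  apply is_lim_seq_plus'; apply is_lim_seq_mult';
    apply is_lim_seq_minus'; trivial; apply is_lim_seq_const. }
assert (Hsum : forall n K, is_lim_seq
   (fun m => sum_n (fun k => weight k * Cmod (coef (u n) k - coef (u m) k)%C ^ 2) K)
   (sum_n (fun k => weight k * Cmod (coef (u n) k - a k)%C ^ 2) K)).
{ intros n K. induction K as [|K IH].
  - rewrite sum_O. eapply is_lim_seq_ext; [ | apply (Hlim n 0%nat)].
    intros m. now rewrite sum_O.
  - rewrite sum_Sn.
    apply is_lim_seq_ext with (fun m =>
      sum_n (fun k => weight k * Cmod (coef (u n) k - coef (u m) k)%C ^ 2) K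
      + weight (S K) * Cmod (coef (u n) (S K) - coef (u m) (S K))%C ^ 2).
    { intros m. now rewrite sum_Sn. }
    apply is_lim_seq_plus'; [exact IH | apply Hlim]. }
assert (Hbd : forall eps, 0 < eps -> exists N : nat, forall n, (N <= n)%nat ->
   forall K, sum_n (fun k => weight k * Cmod (coef (u n) k - a k)%C ^ 2) K <= eps).
{ intros eps He. destruct (H eps He) as [N HN]. exists N. intros n Hn K.
  refine (is_lim_seq_le_loc _ _ _ (Finite eps) _ (Hsum n K)
            (is_lim_seq_const eps)).
  exists N. intros m Hm.
  eapply Rle_trans; [ | exact (HN n m Hn Hm)].
  rewrite H22_inner_self_re.
  eapply Rle_trans; [ | apply (sum_n_le_Series _ K)].
  - apply Req_le, sum_n_ext. intros k. now rewrite coef_minus.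
  - intros k. apply weight_sq_ge_0.
  - apply (coef_summable (H22_minus (u n) (u m))). }
destruct (Hbd 1 Rlt_0_1) as [N0 HN0].
assert (Hd : ex_series (fun k => weight k * Cmod (coef (u N0) k - a k)%C ^ 2)).
{ apply ex_series_bounded with 1.
  - intros k. apply weight_sq_ge_0.
  - now apply HN0. }
set (d := mkH22 (fun k => coef (u N0) k - a k)%C Hd).
exists (H22_minus (u N0) d).
intros eps He. destruct (Hbd eps He) as [N HN]. exists N. intros n Hn.
rewrite H22_inner_self_re.
apply ex_series_bounded.
- intros k. apply weight_sq_ge_0.
- intros K. eapply Rle_trans; [ | apply (HN n Hn K)].
  apply Req_le, sum_n_ext. intros k. rewrite !coef_minus.
  unfold d; simpl coef.
  replace (coef (u n) k - (coef (u N0) k - (coef (u N0) k - a k)))%C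
    with (coef (u n) k - a k)%C by ring. reflexivity.
Qed.

Definition H22_Hilbert : HilbertSpace := {|
  hs_space := H22_ModuleSpace;
  inner := H22_inner;
  inner_plus_l := H22_inner_plus_l;
  inner_scal_l := H22_inner_scal_l;
  inner_conj := H22_inner_conj;
  inner_ge_0 := H22_inner_ge_0;
  inner_eq_0 := H22_inner_eq_0;
  inner_complete := H22_inner_complete
|}.

(** On coefficients, f(z) |-> conj (f (conj z)) is a_n |-> conj a_n; see
    [J_eval]. *)
Definition J_map (f : H22) : H22 :=
  mkH22 (fun n => Cconj (coef f n)) (H22_conj_summable f).

Lemma J_eval (f : H22) (z : C) :
  H22_eval (J_map f) z = Cconj (H22_eval f (Cconj z)).
Proof.
unfold H22_eval. rewrite <- CSeries_conj.
apply CSeries_ext; intros n; simpl.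
now rewrite Cmult_conj, Cpow_conj, Cconj_conj.
Qed.

Lemma J_plus (f g : H22_Hilbert) :
  J_map (plus f g) = plus (J_map f : H22_Hilbert) (J_map g).
Proof. apply H22_ext; intros n. apply Cplus_conj. Qed.

Lemma J_scal (c : C) (f : H22_Hilbert) :
  J_map (scal c f) = scal (Cconj c) (J_map f : H22_Hilbert).
Proof. apply H22_ext; intros n. apply Cmult_conj. Qed.

Lemma J_invol (f : H22_Hilbert) : J_map (J_map f) = f.
Proof. apply H22_ext; intros n. apply Cconj_conj. Qed.

Lemma J_inner (f g : H22_Hilbert) :
  inner (J_map f : H22_Hilbert) (J_map g) = inner g f.
Proof. apply CSeries_ext; intros n; simpl. rewrite Cconj_conj. ring. Qed.

Definition J : conjugation H22_Hilbert :=
  Build_conjugation H22_Hilbert J_map J_plus J_scal J_invol J_inner.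

(** * Weighted composition operators *)

(** [T] is W_{Psi,phi} as a map from H^2_2(D) to itself; such a [T] exists only
    when Psi * (f o phi) stays in H^2_2(D) for every f, and it is then unique. *)
Definition is_weighted_composition (Psi phi : C -> C)
    (T : H22_Hilbert -> H22_Hilbert) : Prop :=
  forall (f : H22_Hilbert) (z : C), disk z ->
    H22_eval (T f) z = (Psi z * H22_eval f (phi z))%C.

Definition W_complex_symmetric (Psi phi : C -> C) : Prop :=
  exists T : H22_Hilbert -> H22_Hilbert,
    is_weighted_composition Psi phi T /\ complex_symmetric T J.

(** * The functions p and q *)

Definition p_fun (a0 z : C) : C :=
  (RtoC (2 / 243) *
   CSeries (fun n => RtoC ((INR n + 1) / (INR n + 2) ^ 5) * a0 ^ n * z ^ n))%C.

(** The sum over n >= 1 is indexed by m = n - 1. *)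
Definition q_fun (a0 z : C) : C :=
  (RtoC (1 / 32) *
   CSeries (fun m => let n := S m in
     RtoC (INR n * (INR n + 1) / (INR n + 2) ^ 5) * a0 ^ (n - 1) * z ^ n))%C.

(* Main.v *)
Require Import Defs.
From Stdlib Require Import Reals Lra Lia Psatz.
From Coquelicot Require Import Coquelicot.

(** Write [k t] for the sum of [(n + 1) / (n + 2) ^ 5 * t ^ n], so that [K_w z = k (conj w * z)].
    Since the adjoint of [W] sends [K_w] to [conj (Psi w) K_(phi w)], complex
    symmetry with respect to [J], tested on kernels, reads
    [Psi z * k (w * phi z) = Psi w * k (z * phi w)] for all [z], [w] in the disk.
    At [w = 0] this gives [Psi z = 32 * Psi 0 * k (a0 * z)], and the coefficient
    of [w] gives [phi]; [k] has no zero in the disk because its constant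
    term dominates.  For these [Psi] and [phi] the coefficient of [w ^ 2] amounts
    to [a1 = 0] or [2 c_0 c_2 k' ^ 2 = c_1 ^ 2 k k''] along [a0 * z], and the coefficient
    of [z] in the latter is
    [a0 * 8 c_0 c_1 c_2 ^ 2 = a0 * (2 c_1 ^ 3 c_2 + 6 c_0 c_1 ^ 2 c_3)], which
    forces [a0 = 0].  These coefficients are those of expansions modulo [o(w)] and
    [o(w ^ 2)], so no power series expansion of [phi] is needed. *)

Local Open Scope R_scope.

(** * Expansions at 0 modulo [o(w ^ N)] *)

Definition near0 (P : C -> Prop) : Prop :=
  exists r : R, 0 < r /\ forall w : C, Cmod w < r -> P w.

(** The centre is included, so [littleo N f] also forces [f 0 = 0], and the constant term of a jet
    of [f] is [f 0]. *)
Definition littleo (N : nat) (f : C -> C) : Prop :=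
  forall eps : R, 0 < eps -> near0 (fun w => Cmod (f w) <= eps * Cmod w ^ N).

(** For [N = 1] the coefficient [c] is irrelevant. *)
Definition jet (N : nat) (f : C -> C) (a b c : C) : Prop :=
  littleo N (fun w => f w - (a + b * w + c * w ^ 2))%C.

Lemma near0_and (P Q : C -> Prop) :
  near0 P -> near0 Q -> near0 (fun w => P w /\ Q w).
Proof.
intros [r [Hr HP]] [s [Hs HQ]]. exists (Rmin r s). split.
- now apply Rmin_pos.
- intros w Hw. assert (H1 := Rmin_l r s). assert (H2 := Rmin_r r s).
  split; [apply HP | apply HQ]; lra.
Qed.

Lemma near0_mono (P Q : C -> Prop) :
  (forall w, P w -> Q w) -> near0 P -> near0 Q.
Proof. intros H [r [Hr HP]]. exists r. auto. Qed.

Lemma near0_true (P : C -> Prop) : (forall w, P w) -> near0 P.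
Proof. intros H. exists 1. split; [lra | auto]. Qed.

Lemma near0_lt (r : R) : 0 < r -> near0 (fun w => Cmod w < r).
Proof. intros Hr. now exists r. Qed.

Lemma littleo_near0 (N : nat) (f g : C -> C) :
  near0 (fun w => f w = g w) -> littleo N g -> littleo N f.
Proof.
intros E Hg eps He.
generalize (near0_and _ _ E (Hg eps He)). apply near0_mono.
intros w [E1 H]. now rewrite E1.
Qed.

Lemma littleo_plus (N : nat) (f g : C -> C) :
  littleo N f -> littleo N g -> littleo N (fun w => f w + g w)%C.
Proof.
intros Hf Hg eps He.
assert (He2 : 0 < eps / 2) by lra.
generalize (near0_and _ _ (Hf _ He2) (Hg _ He2)). apply near0_mono.
intros w [H1 H2]. eapply Rle_trans; [apply Cmod_triangle|]. lra.
Qed.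

Lemma littleo_mult (N : nat) (M : R) (f g : C -> C) :
  near0 (fun w => Cmod (f w) <= M) -> littleo N g ->
  littleo N (fun w => f w * g w)%C.
Proof.
intros Hf Hg eps He.
assert (Hd : 0 < eps / (Rabs M + 1)).
{ apply Rdiv_lt_0_compat; trivial. generalize (Rabs_pos M). lra. }
generalize (near0_and _ _ Hf (Hg _ Hd)). apply near0_mono.
intros w [H1 H2]. rewrite Cmod_mult.
assert (HM := Rle_abs M). assert (HM0 := Rabs_pos M).
apply Rle_trans with ((Rabs M + 1) * (eps / (Rabs M + 1) * Cmod w ^ N)).
- apply Rmult_le_compat; try apply Cmod_ge_0; lra.
- right. field. lra.
Qed.

Lemma littleo_pow (N : nat) : littleo N (fun w => w ^ S N)%C.
Proof.
intros eps He. apply (near0_mono (fun w => Cmod w < eps)); [ | now apply near0_lt].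
intros w Hw. rewrite Cmod_pow. simpl.
apply Rmult_le_compat_r; [apply pow_le, Cmod_ge_0 | lra].
Qed.

Lemma littleo_bigO (N : nat) (M : R) (f : C -> C) :
  near0 (fun w => Cmod (f w) <= M * Cmod w ^ S N) -> littleo N f.
Proof.
intros Hf eps He.
assert (Hd : 0 < eps / (Rabs M + 1)).
{ apply Rdiv_lt_0_compat; trivial. generalize (Rabs_pos M). lra. }
generalize (near0_and _ _ Hf (littleo_pow N _ Hd)). apply near0_mono.
intros w [H1 H2]. rewrite Cmod_pow in H2.
assert (HM := Rle_abs M). assert (HM0 := Rabs_pos M).
assert (Hw : 0 <= Cmod w ^ S N) by apply pow_le, Cmod_ge_0.
apply Rle_trans with ((Rabs M + 1) * (eps / (Rabs M + 1) * Cmod w ^ N)).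
- apply Rle_trans with ((Rabs M + 1) * Cmod w ^ S N); [nra|].
  apply Rmult_le_compat_l; lra.
- right. field. lra.
Qed.

Lemma littleo_bounded (N : nat) (f : C -> C) :
  littleo N f -> near0 (fun w => Cmod (f w) <= 1).
Proof.
intros Hf.
generalize (near0_and _ _ (Hf 1 Rlt_0_1) (near0_lt 1 Rlt_0_1)). apply near0_mono.
intros w [H1 H2]. assert (Hw := Cmod_ge_0 w).
assert (Cmod w ^ N <= 1) by (rewrite <- (pow1 N); apply pow_incr; lra). lra.
Qed.

Lemma quadratic_bounded (a b c : C) :
  near0 (fun w => Cmod (a + b * w + c * w ^ 2)%C <= Cmod a + Cmod b + Cmod c).
Proof.
apply (near0_mono (fun w => Cmod w < 1)); [ | apply near0_lt; lra].
intros w Hw. assert (H0 := Cmod_ge_0 w).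
eapply Rle_trans; [apply Cmod_triangle|].
apply Rplus_le_compat; [eapply Rle_trans; [apply Cmod_triangle|]; apply Rplus_le_compat_l | ];
  rewrite Cmod_mult.
- generalize (Cmod_ge_0 b); nra.
- rewrite Cmod_pow. assert (Cmod w ^ 2 <= 1) by nra. generalize (Cmod_ge_0 c); nra.
Qed.

Lemma jet_near0 (N : nat) (f g : C -> C) (a b c : C) :
  near0 (fun w => f w = g w) -> jet N g a b c -> jet N f a b c.
Proof.
intros E. apply littleo_near0. revert E. apply near0_mono.
intros w E. now rewrite E.
Qed.

Lemma jet_bounded (N : nat) (f : C -> C) (a b c : C) :
  jet N f a b c -> exists M : R, near0 (fun w => Cmod (f w) <= M).
Proof.
intros H. exists (1 + (Cmod a + Cmod b + Cmod c)).
generalize (near0_and _ _ (littleo_bounded _ _ H) (quadratic_bounded a b c)).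
apply near0_mono. intros w [H1 H2].
replace (f w) with ((f w - (a + b * w + c * w ^ 2)) + (a + b * w + c * w ^ 2))%C by ring.
eapply Rle_trans; [apply Cmod_triangle|]. lra.
Qed.

Lemma jet_quadratic (N : nat) (a b c : C) :
  jet N (fun w => a + b * w + c * w ^ 2)%C a b c.
Proof.
apply littleo_bigO with 0. apply (near0_mono (fun w => Cmod w < 1)); [ | apply near0_lt; lra].
intros w _.
replace (a + b * w + c * w ^ 2 - (a + b * w + c * w ^ 2))%C with (RtoC 0) by ring.
rewrite Cmod_0. lra.
Qed.

Lemma jet_const (N : nat) (a : C) : jet N (fun _ => a) a 0 0.
Proof.
apply jet_near0 with (2 := jet_quadratic N a 0 0).
apply near0_true. intros w. ring.
Qed.

Lemma jet_plus (N : nat) (f g : C -> C) (a b c a' b' c' : C) :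
  jet N f a b c -> jet N g a' b' c' ->
  jet N (fun w => f w + g w)%C (a + a') (b + b') (c + c').
Proof.
intros Hf Hg. apply littleo_near0 with (2 := littleo_plus _ _ _ Hf Hg).
apply near0_true. intros w. ring.
Qed.

(** With [P] and [Q] the two quadratics, [f g - P Q = f (g - Q) + Q (f - P)]; the terms of [P Q] of
    degree 3 and 4 are negligible because [N <= 2]. *)
Lemma jet_mult (N : nat) (f g : C -> C) (a b c a' b' c' : C) :
  (N <= 2)%nat -> jet N f a b c -> jet N g a' b' c' ->
  jet N (fun w => f w * g w)%C
    (a * a') (a * b' + b * a') (a * c' + b * b' + c * a').
Proof.
intros HN Hf Hg.
destruct (jet_bounded _ _ _ _ _ Hf) as [M HM].
assert (H1 := littleo_mult _ _ _ _ HM Hg).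
assert (H2 := littleo_mult _ _ _ _ (quadratic_bounded a' b' c') Hf).
assert (H3 := littleo_mult _ _ _ _
  (quadratic_bounded (b * c' + c * b') (c * c') 0) (littleo_pow 2)).
assert (H4 : littleo N (fun w => (b * c' + c * b' + c * c' * w + 0 * w ^ 2) * w ^ 3)%C).
{ intros eps He. generalize (near0_and _ _ (H3 eps He) (near0_lt 1 Rlt_0_1)).
  apply near0_mono. intros w [H Hw].
  eapply Rle_trans; [exact H|]. apply Rmult_le_compat_l; [lra|].
  replace 2%nat with (N + (2 - N))%nat by lia. rewrite pow_add.
  assert (Hw0 := Cmod_ge_0 w).
  assert (Cmod w ^ (2 - N) <= 1) by (rewrite <- (pow1 (2 - N)); apply pow_incr; lra).
  assert (0 <= Cmod w ^ N) by now apply pow_le. nra. }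
apply littleo_near0 with
  (2 := littleo_plus _ _ _ (littleo_plus _ _ _ H1 H2) H4).
apply near0_true. intros w. ring.
Qed.

Lemma near0_real (P : C -> Prop) :
  near0 P -> exists r : R, 0 < r /\ forall t : R, 0 < t < r -> P (RtoC t).
Proof.
intros [r [Hr H]]. exists r. split; trivial. intros t Ht. apply H.
rewrite Cmod_R, Rabs_pos_eq; lra.
Qed.

(** Near 0 the ratio [|w| ^ N / |w| ^ n] is at most 1, so a single small real [w] gives
    [|a| <= eps], for every [eps]. *)
Lemma littleo_monomial (N n : nat) (a : C) :
  (n <= N)%nat -> littleo N (fun w => a * w ^ n)%C -> a = RtoC 0.
Proof.
intros Hn H. apply Cmod_eq_0. apply Rle_antisym; [ | apply Cmod_ge_0].
apply le_epsilon. intros eps He. rewrite Rplus_0_l.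
destruct (near0_real _ (near0_and _ _ (H eps He) (near0_lt 1 Rlt_0_1))) as [r [Hr Hw]].
destruct (Hw (r / 2)) as [H1 H2]; [lra|].
set (w := RtoC (r / 2)) in *.
assert (Hp : 0 < Cmod w).
{ unfold w. rewrite Cmod_R, Rabs_pos_eq; lra. }
rewrite Cmod_mult, Cmod_pow in H1.
assert (Hpn : 0 < Cmod w ^ n) by now apply pow_lt.
replace N with (n + (N - n))%nat in H1 by lia. rewrite pow_add in H1.
assert (Cmod w ^ (N - n) <= 1) by (rewrite <- (pow1 (N - n)); apply pow_incr; lra).
apply Rmult_le_reg_r with (Cmod w ^ n); trivial.
eapply Rle_trans; [exact H1|]. apply Rmult_le_compat_l; [lra|]. nra.
Qed.

Lemma littleo_le (M N : nat) (f : C -> C) :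
  (M <= N)%nat -> littleo N f -> littleo M f.
Proof.
intros HMN Hf eps He.
generalize (near0_and _ _ (Hf eps He) (near0_lt 1 Rlt_0_1)).
apply near0_mono. intros w [H Hw].
eapply Rle_trans; [exact H|]. apply Rmult_le_compat_l; [lra|].
replace N with (M + (N - M))%nat by lia. rewrite pow_add.
assert (Hw0 := Cmod_ge_0 w).
assert (Cmod w ^ (N - M) <= 1) by (rewrite <- (pow1 (N - M)); apply pow_incr; lra).
assert (0 <= Cmod w ^ M) by now apply pow_le. nra.
Qed.

(** The difference of the two quadratics is [o(w ^ N)]. Its coefficients are eliminated from the
    lowest degree up, the higher terms being absorbed into the error each time. *)
Lemma jet_unique (N : nat) (f : C -> C) (a b c a' b' c' : C) :
  jet N f a b c -> jet N f a' b' c' ->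
  a = a' /\ ((1 <= N)%nat -> b = b') /\ ((2 <= N)%nat -> c = c').
Proof.
intros H H'.
assert (D : littleo N (fun w => (a - a') + (b - b') * w + (c - c') * w ^ 2)%C).
{ apply littleo_near0 with
    (g := fun w => ((f w - (a' + b' * w + c' * w ^ 2))
             + - (1) * (f w - (a + b * w + c * w ^ 2)))%C).
  - apply near0_true. intros w. ring.
  - apply littleo_plus; trivial.
    apply littleo_mult with 1; trivial.
    apply near0_true. intros w. rewrite Cmod_m1. lra. }
assert (E : forall x y : C, (x - y)%C = RtoC 0 -> x = y).
{ intros x y Hxy. replace x with (x - y + y)%C by ring. rewrite Hxy. ring. }
assert (Ha : a = a').
{ apply E, (littleo_monomial 0 0); trivial.
  assert (D0 := littleo_le 0 _ _ (Nat.le_0_l N) D).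
  assert (B : littleo 0 (fun w => - ((b - b') + (c - c') * w + 0 * w ^ 2) * w ^ 1)%C).
  { apply littleo_mult with (Cmod (b - b')%C + Cmod (c - c')%C + Cmod 0); [|apply (littleo_pow 0)].
    eapply near0_mono; [ | apply (quadratic_bounded (b-b') (c-c') 0)].
    intros w Hw. now rewrite Cmod_opp. }
  apply littleo_near0 with (2 := littleo_plus _ _ _ D0 B).
  apply near0_true. intros w. ring. }
assert (Hb : (1 <= N)%nat -> b = b').
{ intros HN. apply E, (littleo_monomial 1 1); trivial.
  assert (D0 := littleo_le 1 _ _ HN D).
  assert (B : littleo 1 (fun w => - (c - c') * w ^ 2)%C).
  { apply littleo_mult with (Cmod (- (c - c'))%C); [|apply (littleo_pow 1)].
    apply near0_true. intros w. lra. }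
  apply littleo_near0 with (2 := littleo_plus _ _ _ D0 B).
  apply near0_true. intros w. rewrite Ha. ring. }
repeat split; trivial.
intros HN. assert (HN1 : (1 <= N)%nat) by lia.
apply E, (littleo_monomial 2 2); trivial.
apply littleo_near0 with (2 := littleo_le 2 _ _ HN D).
apply near0_true. intros w. rewrite Ha, (Hb HN1). ring.
Qed.

(** * Power series with bounded coefficients: majorants and second-order Taylor expansion *)

Lemma CSeries_bound (a : nat -> C) (u : nat -> R) :
  (forall n, Cmod (a n) <= u n) -> ex_series u ->
  ex_series (fun n => Cmod (a n)) /\ Cmod (CSeries a) <= 2 * Series u.
Proof.
intros Hau Hu.
assert (Ha : ex_series (fun n => Cmod (a n))).
{ apply (@ex_series_le R_AbsRing R_CompleteNormedModule _ u); trivial.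
  intros n. change (Rabs (Cmod (a n)) <= u n).
  now rewrite Rabs_pos_eq by apply Cmod_ge_0. }
split; trivial.
(* Real and imaginary parts are bounded separately, whence the factor 2; later only the finiteness
   of the bound matters. *)
assert (Hpart : forall f : C -> R, (forall z, Rabs (f z) <= Cmod z) ->
  Rabs (Series (fun n => f (a n))) <= Series u).
{ intros f Hf. eapply Rle_trans; [apply Series_Rabs|].
  - apply (@ex_series_le R_AbsRing R_CompleteNormedModule _ u); trivial.
    intros n. change (Rabs (Rabs (f (a n))) <= u n). rewrite Rabs_Rabsolu.
    eapply Rle_trans; [apply Hf | apply Hau].
  - apply Series_le; trivial. intros n. split; [apply Rabs_pos|].
    eapply Rle_trans; [apply Hf | apply Hau]. }
assert (HR := Hpart Re re_le_Cmod).
assert (HI := Hpart Im (fun z => Rle_trans _ _ _ (Rmax_r _ _) (Rmax_Cmod z))).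
unfold CSeries.
set (x := Series _) in HR |- *. set (y := Series _) in HI |- *.
replace (x, y) with (RtoC x + Ci * RtoC y)%C
  by (unfold x, y; apply injective_projections; simpl; unfold Re, Im; ring).
eapply Rle_trans; [apply Cmod_triangle|].
rewrite Cmod_mult, !Cmod_R.
replace (Cmod Ci) with 1; [lra|].
unfold Cmod, Ci; simpl. rewrite <- sqrt_1 at 1. f_equal. ring.
Qed.

Lemma CSeries_incr_1 (a : nat -> C) :
  ex_series (fun n => Cmod (a n)) ->
  CSeries a = (a 0%nat + CSeries (fun n => a (S n)))%C.
Proof.
intros H. destruct (CSeries_re_im _ H) as [HR HI]. unfold CSeries.
rewrite (Series_incr_1 _ HR), (Series_incr_1 _ HI).
now destruct (a 0%nat).
Qed.

Lemma ex_series_incr_1_R (a : nat -> R) :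
  ex_series a -> ex_series (fun n => a (S n)).
Proof. apply (ex_series_incr_1 (V := R_NormedModule)). Qed.

(** Up to a constant, this series majorises the third-order Taylor remainder: three applications of
    [conv] to powers produce the factor [(n + 1) ^ 3]. *)
Lemma ex_series_cube_geom (r : R) :
  0 < r < 1 -> ex_series (fun n => (INR n + 1) ^ 3 * r ^ n).
Proof.
intros Hr.
assert (Hn : forall n, 0 < (INR n + 1) ^ 3 * r ^ n).
{ intros n. apply Rmult_lt_0_compat; apply pow_lt; [ | lra].
  generalize (pos_INR n); lra. }
apply ex_series_ext with (fun n => Rabs ((INR n + 1) ^ 3 * r ^ n)).
{ intros n. apply Rabs_pos_eq, Rlt_le, Hn. }
apply ex_series_DAlembert with r; [lra | intros n; generalize (Hn n); lra | ].
apply is_lim_seq_ext with (fun n => (1 + / (INR n + 1)) * ((1 + / (INR n + 1)) *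
  (1 + / (INR n + 1))) * r).
{ intros n. rewrite Rabs_pos_eq by (apply Rlt_le, Rdiv_lt_0_compat; apply Hn).
  rewrite S_INR. simpl. field.
  split; [|generalize (pos_INR n)]; try lra. apply pow_nonzero; lra. }
assert (H1 : is_lim_seq (fun n => 1 + / (INR n + 1)) 1).
{ replace (Finite 1) with (Finite (1 + 0)) by (f_equal; ring).
  apply is_lim_seq_plus'; [apply is_lim_seq_const|].
  apply is_lim_seq_ext with (fun n => / INR (S n)); [intros n; now rewrite S_INR|].
  apply (is_lim_seq_incr_1 (fun n => / INR n)).
  apply (is_lim_seq_inv INR p_infty); [apply is_lim_seq_INR | discriminate]. }
replace (Finite r) with (Finite (1 * (1 * 1) * r)) by (f_equal; ring).
repeat apply is_lim_seq_mult'; trivial. apply is_lim_seq_const.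
Qed.

(** [conv x u n] is the sum of [x ^ (n - 1 - j) * u j] over [j < n]; iterating it
    on powers of [s] yields the Taylor coefficients and remainder of [t ^ n]
    at [s]. *)
Fixpoint conv (x : C) (u : nat -> C) (n : nat) : C :=
  match n with
  | 0%nat => RtoC 0
  | S m => (x * conv x u m + u m)%C
  end.

Lemma conv_pow (s t : C) (n : nat) :
  (t ^ n = s ^ n + (t - s) * conv t (fun m => s ^ m) n)%C.
Proof.
induction n as [|n IH]; simpl conv; [simpl; ring|].
rewrite !Cpow_S, IH at 1. ring.
Qed.

(** On generating functions [conv x] is multiplication by [X / (1 - x X)], and the difference of
    [X / (1 - t X)] and [X / (1 - s X)] is [t - s] times their product. Each use after [conv_pow]
    extends the expansion of [t ^ n] at [s] by one order. *)
Lemma conv_swap (s t : C) (u : nat -> C) (n : nat) :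
  (conv t u n = conv s u n + (t - s) * conv t (conv s u) n)%C.
Proof.
induction n as [|n IH]; simpl; [ring|].
rewrite IH. ring.
Qed.

(** Each [conv] costs one factor [n + 1] and one factor [1 / r]: in the induction the two summands
    combine to [B / r * ((n + 1) ^ j * (n + 2) * r ^ (n + 1))]. *)
Lemma conv_bound (x : C) (u : nat -> C) (B r : R) (j : nat) :
  0 < r -> Cmod x <= r ->
  (forall n, Cmod (u n) <= B * ((INR n + 1) ^ j * r ^ n)) ->
  forall n, Cmod (conv x u n) <= B / r * ((INR n + 1) ^ S j * r ^ n).
Proof.
intros Hr Hx Hu.
assert (HB : 0 <= B).
{ assert (H := Hu 0%nat). simpl in H. rewrite Rplus_0_l, pow1 in H.
  generalize (Cmod_ge_0 (u 0%nat)). lra. }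
assert (HBr : 0 <= B / r) by now apply Rdiv_le_0_compat.
induction n as [|n IH]; simpl conv.
- rewrite Cmod_0. apply Rmult_le_pos; trivial.
  simpl. rewrite Rplus_0_l, pow1. lra.
- eapply Rle_trans; [apply Cmod_triangle|]. rewrite Cmod_mult.
  assert (Hn := pos_INR n).
  apply Rle_trans with
    (r * (B / r * ((INR n + 1) ^ S j * r ^ n)) + B * ((INR n + 1) ^ j * r ^ n)).
  { apply Rplus_le_compat; trivial.
    apply Rmult_le_compat; trivial; apply Cmod_ge_0. }
  rewrite S_INR.
  replace (r * (B / r * ((INR n + 1) ^ S j * r ^ n)) + B * ((INR n + 1) ^ j * r ^ n))
    with (B / r * ((INR n + 1) ^ j * (INR n + 2) * r ^ S n))
    by (simpl; field; lra).
  apply Rmult_le_compat_l; trivial.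
  apply Rmult_le_compat_r; [apply pow_le; lra|].
  replace ((INR n + 1 + 1) ^ S j) with ((INR n + 1 + 1) ^ j * (INR n + 2))
    by (simpl; ring).
  apply Rmult_le_compat_r; [lra|]. apply pow_incr. lra.
Qed.

(** [psum kcoef] is the function [k] of the opening comment; [coef_deriv] then gives [k'] and [k'']
    in the same form. *)
Definition psum (b : nat -> R) (s : C) : C :=
  CSeries (fun n => RtoC (b n) * s ^ n)%C.

Definition coef_deriv (b : nat -> R) (n : nat) : R := (INR n + 1) * b (S n).

Lemma conv_pow_diag (s : C) (n : nat) :
  conv s (fun m => s ^ m)%C (S n) = (RtoC (INR n + 1) * s ^ n)%C.
Proof.
induction n as [|n IH].
- simpl. rewrite Rplus_0_l. ring.
- change (s * conv s (fun m => s ^ m) (S n) + s ^ S n = RtoC (INR (S n) + 1) * s ^ S n)%C.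
  rewrite IH, S_INR, Cpow_S, !RtoC_plus. ring.
Qed.

Lemma conv_conv_pow_diag (s : C) (n : nat) :
  conv s (conv s (fun m => s ^ m)%C) (S (S n)) =
  (RtoC ((INR n + 1) * (INR n + 2) / 2) * s ^ n)%C.
Proof.
induction n as [|n IH].
- simpl. replace ((0 + 1) * (0 + 2) / 2) with 1 by field. ring.
- change (s * conv s (conv s (fun m => s ^ m)) (S (S n)) + conv s (fun m => s ^ m) (S (S n))
    = RtoC ((INR (S n) + 1) * (INR (S n) + 2) / 2) * s ^ S n)%C.
  rewrite IH, conv_pow_diag, S_INR, Cpow_S.
  replace ((INR n + 1 + 1) * (INR n + 1 + 2) / 2)
    with ((INR n + 1) * (INR n + 2) / 2 + (INR n + 1 + 1)) by field.
  rewrite (RtoC_plus _ (INR n + 1 + 1)). ring.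
Qed.

Lemma psum_terms_bound (b : nat -> R) (r B : R) (j : nat) (u : nat -> C) :
  (forall n, Rabs (b n) <= 1) -> 0 < r < 1 ->
  (j <= 3)%nat ->
  (forall n, Cmod (u n) <= B * ((INR n + 1) ^ j * r ^ n)) ->
  ex_series (fun n => Cmod (RtoC (b n) * u n)%C) /\
  Cmod (CSeries (fun n => RtoC (b n) * u n)%C) <=
    2 * (B * Series (fun n => (INR n + 1) ^ 3 * r ^ n)).
Proof.
intros Hb Hr Hj Hu.
assert (HB : 0 <= B).
{ assert (H := Hu 0%nat). simpl in H. rewrite Rplus_0_l, pow1 in H.
  generalize (Cmod_ge_0 (u 0%nat)). lra. }
rewrite <- Series_scal_l. apply CSeries_bound.
- intros n. rewrite Cmod_mult, Cmod_R.
  apply Rle_trans with (1 * Cmod (u n)).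
  { apply Rmult_le_compat_r; [apply Cmod_ge_0 | apply Hb]. }
  rewrite Rmult_1_l. eapply Rle_trans; [apply Hu|].
  apply Rmult_le_compat_l; trivial. apply Rmult_le_compat_r; [apply pow_le; lra|].
  apply Rle_pow; trivial. generalize (pos_INR n); lra.
- apply ex_series_scal_R. now apply ex_series_cube_geom.
Qed.

Lemma pow_terms_bound (r : R) (s : C) (n : nat) :
  Cmod s <= r -> Cmod (s ^ n)%C <= 1 * ((INR n + 1) ^ 0 * r ^ n).
Proof.
intros Hs. rewrite Cmod_pow. simpl. rewrite !Rmult_1_l.
apply pow_incr. split; [apply Cmod_ge_0 | exact Hs].
Qed.

(** Each [t ^ n] is expanded at [s] by [conv_pow] and two uses of [conv_swap], and the results are
    summed. The constant depends on [r] only, through three uses of [conv_bound]. *)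
Lemma psum_taylor (b : nat -> R) (r : R) :
  (forall n, Rabs (b n) <= 1) -> 0 < r < 1 ->
  exists M : R, forall s t : C,
  Cmod s <= r -> Cmod t <= r ->
  Cmod (psum b t - (psum b s + psum (coef_deriv b) s * (t - s)
          + RtoC (/ 2) * psum (coef_deriv (coef_deriv b)) s * (t - s) ^ 2))%C
    <= M * Cmod (t - s)%C ^ 3.
Proof.
intros Hb Hr1. assert (Hr : 0 < r) by lra.
exists (2 * (1 / r / r / r * Series (fun n => (INR n + 1) ^ 3 * r ^ n))).
intros s t Hs Ht.
set (P0 := fun m => (s ^ m)%C). set (P1 := conv s P0). set (P2 := conv s P1).
set (P3 := conv t P2). set (h := (t - s)%C).
assert (B1 := conv_bound s P0 _ _ _ Hr Hs (fun n => pow_terms_bound r s n Hs)).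
assert (B2 := conv_bound s _ _ _ _ Hr Hs B1).
assert (B3 := conv_bound t _ _ _ _ Hr Ht B2).
assert (L : (0 <= 3 /\ 1 <= 3 /\ 2 <= 3 /\ 3 <= 3)%nat) by lia.
destruct L as [L0 [L1 [L2 L3]]].
destruct (psum_terms_bound b r _ _ P0 Hb Hr1 L0 (fun n => pow_terms_bound r s n Hs)) as [E0 _].
destruct (psum_terms_bound b r _ _ _ Hb Hr1 L1 B1) as [E1 _].
destruct (psum_terms_bound b r _ _ _ Hb Hr1 L2 B2) as [E2 _].
destruct (psum_terms_bound b r _ _ _ Hb Hr1 L3 B3) as [E3 F3].
fold P1 in E1. fold P1 P2 in E2. fold P1 P2 P3 in E3, F3.
(* [P1] vanishes at index 0, so dropping that term shifts the index and leaves the derived series;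
   for [P2] two terms drop. *)
assert (S1 : psum (coef_deriv b) s = CSeries (fun n => RtoC (b n) * P1 n)%C).
{ rewrite (CSeries_incr_1 _ E1).
  replace (P1 0%nat) with (RtoC 0) by reflexivity.
  rewrite Cmult_0_r, Cplus_0_l. apply CSeries_ext; intros n.
  unfold P1, P0. rewrite conv_pow_diag. unfold coef_deriv. rewrite RtoC_mult. ring. }
assert (S2 : (RtoC (/ 2) * psum (coef_deriv (coef_deriv b)) s)%C =
          CSeries (fun n => RtoC (b n) * P2 n)%C).
{ assert (E2' : ex_series (fun n => Cmod (RtoC (b (S n)) * P2 (S n))%C))
    by exact (ex_series_incr_1_R _ E2).
  rewrite (CSeries_incr_1 _ E2), (CSeries_incr_1 _ E2').
  replace (P2 0%nat) with (RtoC 0) by reflexivity.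
  replace (P2 1%nat) with (RtoC 0) by (unfold P2, P1; simpl; ring).
  rewrite !Cmult_0_r, !Cplus_0_l.
  assert (E2'' : ex_series (fun n => Cmod (RtoC (b (S (S n))) * P2 (S (S n)))%C))
    by exact (ex_series_incr_1_R _ E2').
  assert (Q : forall n, (RtoC (coef_deriv (coef_deriv b) n) * s ^ n =
     2 * (RtoC (b (S (S n))) * P2 (S (S n))))%C).
  { intros n. unfold P2, P1, P0. rewrite conv_conv_pow_diag. unfold coef_deriv.
    rewrite S_INR.
    replace ((INR n + 1) * ((INR n + 1 + 1) * b (S (S n)))) with
      (2 * (b (S (S n)) * ((INR n + 1) * (INR n + 2) / 2))) by field.
    rewrite !(RtoC_mult 2), (RtoC_mult (b _)). ring. }
  unfold psum. rewrite (CSeries_ext _ _ Q), CSeries_scal by exact E2''.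
  rewrite Cmult_assoc, <- RtoC_mult. replace (/ 2 * 2) with 1 by field. apply Cmult_1_l. }
assert (St : psum b t = (psum b s + h * CSeries (fun n => RtoC (b n) * P1 n)
   + h ^ 2 * CSeries (fun n => RtoC (b n) * P2 n)
   + h ^ 3 * CSeries (fun n => RtoC (b n) * P3 n))%C).
{ assert (K : forall (c : C) (a : nat -> C), ex_series (fun n => Cmod (a n)) ->
    ex_series (fun n => Cmod (c * a n)%C)).
  { intros c a Ha. apply ex_series_ext with (fun n => Cmod c * Cmod (a n)).
    - intros n. now rewrite Cmod_mult.
    - now apply ex_series_scal_R. }
  assert (K2 : forall a a' : nat -> C, ex_series (fun n => Cmod (a n)) ->
    ex_series (fun n => Cmod (a' n)) -> ex_series (fun n => Cmod (a n + a' n)%C)).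
  { intros a a' Ha Ha'.
    apply (@ex_series_le R_AbsRing R_CompleteNormedModule _
             (fun n => Cmod (a n) + Cmod (a' n))).
    - intros n. change (Rabs (Cmod (a n + a' n)%C) <= Cmod (a n) + Cmod (a' n)).
      rewrite Rabs_pos_eq by apply Cmod_ge_0. apply Cmod_triangle.
    - now apply (ex_series_plus (V := R_NormedModule)). }
  rewrite <- !CSeries_scal by assumption. unfold psum. fold P0.
  change (fun n => RtoC (b n) * s ^ n)%C with (fun n => RtoC (b n) * P0 n)%C.
  rewrite <- CSeries_plus by auto.
  rewrite <- CSeries_plus by auto.
  rewrite <- CSeries_plus by auto.
  apply CSeries_ext; intros n.
  rewrite (conv_pow s t n). fold P0. rewrite (conv_swap s t P0 n). fold P1.
  rewrite (conv_swap s t P1 n). fold P2 P3. unfold P0, h. ring. }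
rewrite St, S1, S2, <- Cmod_pow.
match goal with |- Cmod ?x <= _ =>
  replace x with (CSeries (fun n => RtoC (b n) * P3 n) * h ^ 3)%C by ring end.
rewrite Cmod_mult. apply Rmult_le_compat_r; [apply Cmod_ge_0 | exact F3].
Qed.

(** The chain rule to second order: the Taylor polynomial at [s] is composed with the jet of
    [g w - s], and the remainder is cubic in [g w - s]. The radius [r] keeps [g w] where the Taylor
    constant is uniform. *)
Lemma jet_comp_psum (N : nat) (b : nat -> R) (r : R) (g : C -> C) (s g1 g2 : C) :
  (1 <= N <= 2)%nat ->
  (forall n, Rabs (b n) <= 1) -> 0 < r < 1 -> Cmod s <= r ->
  near0 (fun w => Cmod (g w) <= r) -> jet N g s g1 g2 ->
  jet N (fun w => psum b (g w)) (psum b s) (psum (coef_deriv b) s * g1)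
    (psum (coef_deriv b) s * g2
     + RtoC (/ 2) * psum (coef_deriv (coef_deriv b)) s * g1 ^ 2).
Proof.
intros HN Hb Hr Hs Hg Hj.
destruct (psum_taylor b r Hb Hr) as [M HM].
set (k1 := psum (coef_deriv b) s). set (k2 := (RtoC (/ 2) * _)%C).
assert (Hh : jet N (fun w => g w - s)%C 0 g1 g2).
{ assert (H := jet_plus _ _ _ _ _ _ _ _ _ Hj (jet_const N (- s)%C)).
  replace (s + - s)%C with (RtoC 0) in H by ring. now rewrite !Cplus_0_r in H. }
assert (HN2 : (N <= 2)%nat) by lia.
assert (Hpoly : jet N (fun w => psum b s + k1 * (g w - s) + k2 * (g w - s) ^ 2)%C
   (psum b s) (k1 * g1) (k1 * g2 + k2 * g1 ^ 2)).
{ assert (H := jet_plus _ _ _ _ _ _ _ _ _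
   (jet_plus _ _ _ _ _ _ _ _ _ (jet_const N (psum b s))
      (jet_mult _ _ _ _ _ _ _ _ _ HN2 (jet_const N k1) Hh))
   (jet_mult _ _ _ _ _ _ _ _ _ HN2 (jet_const N k2)
      (jet_mult _ _ _ _ _ _ _ _ _ HN2 Hh Hh))).
  match type of H with jet _ _ ?x ?y ?z =>
    replace x with (psum b s) in H by ring;
    replace y with (k1 * g1)%C in H by ring;
    replace z with (k1 * g2 + k2 * g1 ^ 2)%C in H by ring end.
  apply jet_near0 with (2 := H). apply near0_true. intros w. ring. }
assert (Hrem : littleo N (fun w =>
   psum b (g w) - (psum b s + k1 * (g w - s) + k2 * (g w - s) ^ 2))%C).
(* As [1 <= N], the jet gives [g w - s = O(w)], so the cubic remainder is [O(w ^ 3)]. *)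
{ assert (HL : near0 (fun w => Cmod (g w - s)%C <= (1 + Cmod g1 + Cmod g2) * Cmod w)).
  { generalize (near0_and _ _ (littleo_le 1 _ _ (proj1 HN) Hh 1 Rlt_0_1) (near0_lt 1 Rlt_0_1)).
    apply near0_mono. intros w [H1 H2].
    replace (g w - s)%C with
      ((g w - s - (0 + g1 * w + g2 * w ^ 2)) + (g1 * w + g2 * w ^ 2))%C by ring.
    eapply Rle_trans; [apply Cmod_triangle|].
    assert (H3 := Cmod_triangle (g1 * w)%C (g2 * w ^ 2)%C).
    rewrite !Cmod_mult, Cmod_pow in H3. assert (Hw := Cmod_ge_0 w).
    assert (Cmod w ^ 2 <= Cmod w) by nra. generalize (Cmod_ge_0 g2).
    rewrite pow_1 in H1. intros; nra. }
  apply (littleo_le N 2); trivial.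
  apply littleo_bigO with (Rabs M * (1 + Cmod g1 + Cmod g2) ^ 3).
  generalize (near0_and _ _ HL Hg). apply near0_mono. intros w [H1 H2].
  eapply Rle_trans; [apply (HM s (g w) Hs H2)|].
  rewrite Rmult_assoc, <- Rpow_mult_distr.
  apply Rle_trans with (Rabs M * Cmod (g w - s)%C ^ 3).
  - apply Rmult_le_compat_r; [apply pow_le, Cmod_ge_0 | apply Rle_abs].
  - apply Rmult_le_compat_l; [apply Rabs_pos|].
    apply pow_incr. split; [apply Cmod_ge_0 | exact H1]. }
apply littleo_near0 with (2 := littleo_plus _ _ _ Hrem Hpoly).
apply near0_true. intros w. ring.
Qed.

Lemma psum_abs (b : nat -> R) (s : C) :
  (forall n, Rabs (b n) <= 1) -> disk s ->
  ex_series (fun n => Cmod (RtoC (b n) * s ^ n)%C).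
Proof.
intros Hb Hs. apply (CSeries_bound _ (fun n => Cmod s ^ n)).
- intros n. rewrite Cmod_mult, Cmod_R, Cmod_pow.
  assert (0 <= Cmod s ^ n) by apply pow_le, Cmod_ge_0.
  generalize (Hb n). intros; nra.
- apply ex_series_geom. now rewrite Rabs_pos_eq by apply Cmod_ge_0.
Qed.

Lemma disk_0 : disk 0.
Proof. unfold disk. rewrite Cmod_0. lra. Qed.

Lemma disk_mult (z w : C) : disk z -> disk w -> disk (z * w).
Proof.
unfold disk. rewrite Cmod_mult. generalize (Cmod_ge_0 z) (Cmod_ge_0 w).
intros; nra.
Qed.

Lemma disk_conj (z : C) : disk z -> disk (Cconj z).
Proof. unfold disk. now rewrite Cmod_conj. Qed.

Lemma psum_0 (b : nat -> R) : psum b 0 = RtoC (b 0%nat).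
Proof.
assert (Z : ex_series (fun _ : nat => Cmod 0)).
{ apply ex_series_ext with (fun n => 0 * (/ 2) ^ n).
  - intros n. rewrite Cmod_0. apply Rmult_0_l.
  - apply ex_series_scal_R, ex_series_geom. rewrite Rabs_pos_eq; lra. }
assert (T : forall n, (RtoC (b (S n)) * 0 ^ S n)%C = (0 * 0)%C) by (intros n; simpl; ring).
assert (H : ex_series (fun n => Cmod (RtoC (b n) * 0 ^ n)%C)).
{ apply (ex_series_incr_1 (V := R_NormedModule)).
  apply ex_series_ext with (2 := Z). intros n. rewrite T. f_equal. ring. }
unfold psum. rewrite (CSeries_incr_1 _ H), (CSeries_ext _ _ T), CSeries_scal by exact Z.
simpl. ring.
Qed.

(** * The kernel function [k], its lack of zeros in the disk, and its relation to [p] and [q] *)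

Definition kcoef (n : nat) : R := (INR n + 1) / (INR n + 2) ^ 5.

Lemma kcoef_ge_0 (n : nat) : 0 <= kcoef n.
Proof.
assert (Hn := pos_INR n). apply Rdiv_le_0_compat; [lra | apply pow_lt; lra].
Qed.

Lemma weight_kcoef (n : nat) : weight n * kcoef n = 1.
Proof.
assert (Hn := pos_INR n). unfold weight, kcoef. field. split; lra.
Qed.

(** Two differentiations raise the numerator only to degree 3 in [n], against a fifth power below.
    This makes the [psum] lemmas available for [k], [k'] and [k'']. *)
Lemma kcoef_deriv_bounds (n : nat) :
  Rabs (kcoef n) <= 1 /\ Rabs (coef_deriv kcoef n) <= 1 /\
  Rabs (coef_deriv (coef_deriv kcoef) n) <= 1.
Proof.
assert (Hn := pos_INR n).
unfold coef_deriv, kcoef. rewrite !S_INR.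
set (x := INR n) in *.
assert (H : forall y d : R, 0 <= y -> 0 < d -> y <= d -> Rabs (y / d) <= 1).
{ intros y d Hy Hd Hyd. rewrite Rabs_pos_eq by now apply Rdiv_le_0_compat.
  apply Rmult_le_reg_r with d; trivial. unfold Rdiv. rewrite Rmult_assoc, Rinv_l by lra. lra. }
assert (P : forall a m, 1 <= a -> (m <= 5)%nat -> a ^ m <= a ^ 5)
  by (intros; now apply Rle_pow).
repeat split.
- apply H; [lra | apply pow_lt; lra|].
  apply Rle_trans with ((x + 2) ^ 1); [simpl; lra | apply P; [lra | lia]].
- replace ((x + 1) * ((x + 1 + 1) / (x + 1 + 2) ^ 5))
    with ((x + 1) * (x + 2) / (x + 3) ^ 5).
  2:{ replace (x + 1 + 2) with (x + 3) by ring. field. lra. }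
  apply H; [nra | apply pow_lt; lra|].
  apply Rle_trans with ((x + 3) ^ 2); [simpl; nra | apply P; [lra | lia]].
- replace ((x + 1) * ((x + 1 + 1) * ((x + 1 + 1 + 1) / (x + 1 + 1 + 2) ^ 5)))
    with ((x + 1) * (x + 2) * (x + 3) / (x + 4) ^ 5).
  2:{ replace (x + 1 + 1 + 2) with (x + 4) by ring. field. lra. }
  apply H; [ | apply pow_lt; lra | ].
  + apply Rmult_le_pos; nra.
  + apply Rle_trans with ((x + 4) ^ 3); [ | apply P; [lra | lia]].
    replace ((x + 4) ^ 3) with ((x + 4) * (x + 4) * (x + 4)) by ring.
    apply Rmult_le_compat; nra.
Qed.

Definition kcoef_le n := proj1 (kcoef_deriv_bounds n).
Definition kcoef_deriv_le n := proj1 (proj2 (kcoef_deriv_bounds n)).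
Definition kcoef_deriv2_le n := proj2 (proj2 (kcoef_deriv_bounds n)).

(** The constant term 1/32 dominates the sum of the other coefficients: they
    are bounded by [4 / 81 * (1 / (n + 2) - 1 / (n + 3))], which telescopes
    to 2/81. *)
Lemma kernel_re_bound (s : C) : disk s -> 1 / 200 <= Re (psum kcoef s).
Proof.
intros Hs.
assert (Ha := psum_abs _ s kcoef_le Hs).
destruct (CSeries_re_im _ Ha) as [HR _].
assert (T : forall n, sum_n (fun k => kcoef (S k)) n <= 4 / 81 * (/ 2 - / (INR n + 3))).
{ assert (Tn : forall n, kcoef (S n) <= 4 / 81 * (/ (INR n + 2) - / (INR n + 3))).
  { intros n. assert (Hn := pos_INR n). unfold kcoef. rewrite S_INR.
    set (x := INR n) in *.
    apply Rminus_le_0.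
    replace (4 / 81 * (/ (x + 2) - / (x + 3)) - (x + 1 + 1) / (x + 1 + 2) ^ 5)
      with ((4 * (x + 3) ^ 4 - 81 * (x + 2) ^ 2) / (81 * (x + 2) * (x + 3) ^ 5)).
    2:{ replace (x + 1 + 2) with (x + 3) by ring. field. split; lra. }
    apply Rdiv_le_0_compat.
    (* A difference of squares whose first factor is [2 * x ^ 2 + 3 * x]; the constant [4 / 81] is
       thus attained at [n = 0]. *)
    - replace (4 * (x + 3) ^ 4 - 81 * (x + 2) ^ 2) with
        ((2 * (x + 3) ^ 2 - 9 * (x + 2)) * (2 * (x + 3) ^ 2 + 9 * (x + 2))) by ring.
      apply Rmult_le_pos; nra.
    - apply Rmult_lt_0_compat; [lra | apply pow_lt; lra]. }
  induction n as [|n IH].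
  - rewrite sum_O. eapply Rle_trans; [apply Tn|]. simpl. rewrite !Rplus_0_l. lra.
  - rewrite sum_Sn. unfold plus; simpl AbelianMonoid.plus.
    eapply Rle_trans; [apply Rplus_le_compat; [exact IH | apply (Tn (S n))]|].
    rewrite S_INR. replace (INR n + 1 + 2) with (INR n + 3) by ring. lra. }
assert (T' : ex_series (fun k => kcoef (S k)) /\ Series (fun k => kcoef (S k)) <= 2 / 81).
{ apply ex_series_bounded; [intros k; apply kcoef_ge_0|].
  intros n. eapply Rle_trans; [apply T|].
  assert (0 < / (INR n + 3)) by (apply Rinv_0_lt_compat; generalize (pos_INR n); lra).
  lra. }
destruct T' as [Te Tb].
assert (Hb : forall n, Rabs (Re (RtoC (kcoef (S n)) * s ^ S n)%C) <= kcoef (S n)).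
{ intros n. eapply Rle_trans; [apply re_le_Cmod|].
  rewrite Cmod_mult, Cmod_R, Cmod_pow, Rabs_pos_eq by apply kcoef_ge_0.
  assert (Cmod s ^ S n <= 1).
  { rewrite <- (pow1 (S n)). apply pow_incr. split; [apply Cmod_ge_0 | apply Rlt_le, Hs]. }
  generalize (kcoef_ge_0 (S n)). intros; nra. }
assert (Hser : Rabs (Series (fun n => Re (RtoC (kcoef (S n)) * s ^ S n)%C)) <= 2 / 81).
{ eapply Rle_trans; [apply Series_Rabs|eapply Rle_trans; [apply Series_le|exact Tb]].
  - apply (@ex_series_le R_AbsRing R_CompleteNormedModule _ (fun k => kcoef (S k))); trivial.
    intros n. change (Rabs (Rabs (Re (RtoC (kcoef (S n)) * s ^ S n)%C)) <= kcoef (S n)).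
    rewrite Rabs_Rabsolu. apply Hb.
  - intros n. split; [apply Rabs_pos | apply Hb].
  - exact Te. }
change (1 / 200 <= Series (fun n => Re (RtoC (kcoef n) * s ^ n)%C)).
rewrite (Series_incr_1 _ HR).
(* The margin is [1 / 32 - 2 / 81 = 17 / 2592], which exceeds [1 / 200]. *)
apply Rabs_le_between in Hser.
replace (Re (RtoC (kcoef 0) * s ^ 0)%C) with (1 / 32); [lra|].
rewrite re_scal_l. unfold kcoef. simpl. field.
Qed.

Lemma kernel_mod_bound (s : C) : disk s -> 1 / 200 <= Cmod (psum kcoef s).
Proof.
intros Hs. eapply Rle_trans; [exact (kernel_re_bound s Hs)|].
eapply Rle_trans; [apply Rle_abs | apply re_le_Cmod].
Qed.

Lemma kernel_neq_0 (s : C) : disk s -> psum kcoef s <> RtoC 0.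
Proof.
intros Hs. apply Cmod_gt_0. generalize (kernel_mod_bound s Hs). lra.
Qed.

Lemma p_fun_psum (a0 z : C) : p_fun a0 z = (RtoC (2 / 243) * psum kcoef (a0 * z))%C.
Proof.
unfold p_fun, psum. f_equal. apply CSeries_ext; intros n.
rewrite Cpow_mult_l. unfold kcoef. ring.
Qed.

Lemma q_fun_psum (a0 z : C) :
  disk a0 -> disk z ->
  q_fun a0 z = (RtoC (1 / 32) * (z * psum (coef_deriv kcoef) (a0 * z)))%C.
Proof.
intros Ha Hz. unfold q_fun, psum. f_equal.
rewrite <- CSeries_scal by (apply psum_abs; [apply kcoef_deriv_le | now apply disk_mult]).
apply CSeries_ext; intros n. cbv zeta. rewrite Cpow_mult_l.
replace (S n - 1)%nat with n by lia. rewrite Cpow_S.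
unfold coef_deriv, kcoef.
replace ((INR n + 1) * ((INR (S n) + 1) / (INR (S n) + 2) ^ 5))
  with (INR (S n) * (INR (S n) + 1) / (INR (S n) + 2) ^ 5)
  by (rewrite (S_INR n); unfold Rdiv; ring).
ring.
Qed.

(** * Reproducing kernels and the identity that symmetry imposes on them *)

Lemma kernel_summable (w : C) : disk w ->
  ex_series (fun n => weight n * Cmod (RtoC (kcoef n) * Cconj w ^ n)%C ^ 2).
Proof.
intros Hw.
apply (@ex_series_le R_AbsRing R_CompleteNormedModule _ (fun n => Cmod w ^ n)).
- intros n.
  change (Rabs (weight n * Cmod (RtoC (kcoef n) * Cconj w ^ n)%C ^ 2) <= Cmod w ^ n).
  rewrite Rabs_pos_eq by apply weight_sq_ge_0.
  rewrite Cmod_mult, Cmod_R, Cmod_pow, Cmod_conj, Rabs_pos_eq by apply kcoef_ge_0.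
  replace (weight n * (kcoef n * Cmod w ^ n) ^ 2)
    with (weight n * kcoef n * (kcoef n * Cmod w ^ n * Cmod w ^ n)) by ring.
  rewrite weight_kcoef.
  assert (H0 : 0 <= Cmod w ^ n) by apply pow_le, Cmod_ge_0.
  assert (H1 : Cmod w ^ n <= 1).
  { rewrite <- (pow1 n). apply pow_incr. split; [apply Cmod_ge_0 | apply Rlt_le, Hw]. }
  assert (H2 := kcoef_le n). rewrite Rabs_pos_eq in H2 by apply kcoef_ge_0.
  assert (H3 := kcoef_ge_0 n).
  assert (kcoef n * Cmod w ^ n <= 1) by nra. nra.
- apply ex_series_geom. now rewrite Rabs_pos_eq by apply Cmod_ge_0.
Qed.

Definition kernel (w : C) (Hw : disk w) : H22 :=
  mkH22 (fun n => RtoC (kcoef n) * Cconj w ^ n)%C (kernel_summable w Hw).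

Lemma kernel_eval (w z : C) (Hw : disk w) :
  H22_eval (kernel w Hw) z = psum kcoef (Cconj w * z).
Proof.
apply CSeries_ext; intros n. simpl. rewrite Cpow_mult_l. ring.
Qed.

Lemma kernel_reproducing (f : H22) (w : C) (Hw : disk w) :
  H22_inner f (kernel w Hw) = H22_eval f w.
Proof.
apply CSeries_ext; intros n. simpl coef.
rewrite Cmult_conj, Cconj_R, Cpow_conj, Cconj_conj.
replace (RtoC (weight n) * coef f n * (RtoC (kcoef n) * w ^ n))%C
  with (RtoC (weight n * kcoef n) * (coef f n * w ^ n))%C
  by (rewrite RtoC_mult; ring).
rewrite weight_kcoef. ring.
Qed.

(* Complex symmetry tested on kernels: W* K_w = conj (Psi w) K_(phi w). *)
Lemma complex_symmetric_kernel_identity (Psi phi : C -> C) :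
  (forall z, disk z -> disk (phi z)) -> W_complex_symmetric Psi phi ->
  forall z w, disk z -> disk w ->
  (Psi z * psum kcoef (w * phi z) = Psi w * psum kcoef (z * phi w))%C.
Proof.
intros Hphi [T [HT [_ [S [HS HC]]]]] z w Hz Hw.
assert (E : H22_eval (T (J (kernel w Hw))) z = H22_eval (J (S (kernel w Hw))) z)
  by now rewrite HC.
rewrite HT in E by trivial. simpl in E. rewrite !J_eval, kernel_eval in E.
assert (Hz' := disk_conj z Hz).
(* The value of [S K_w] at [conj z] becomes an inner product with the kernel at [conj z], so that
   adjointness replaces [S] by [T]. *)
rewrite <- (kernel_reproducing _ _ Hz'), <- H22_inner_conj in E.
assert (A := HS (kernel (Cconj z) Hz') (kernel w Hw)). simpl in A.
rewrite <- A, kernel_reproducing, HT, kernel_eval, Cconj_conj in E by trivial.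
(* The coefficients of [k] are real, so conjugation passes to its argument. *)
rewrite <- E. f_equal. unfold psum. rewrite <- CSeries_conj.
apply CSeries_ext; intros n.
now rewrite Cmult_conj, Cpow_conj, Cmult_conj, !Cconj_conj, Cconj_R.
Qed.

(** * Jets of the kernel and of quotients, and comparison of coefficients *)

Lemma jet_id (N : nat) : jet N (fun w => w) 0 1 0.
Proof.
apply jet_near0 with (2 := jet_quadratic N 0 1 0).
apply near0_true. intros w. ring.
Qed.

Lemma jet_ext (N : nat) (f : C -> C) (a b c a' b' c' : C) :
  a = a' -> b = b' -> c = c' -> jet N f a b c -> jet N f a' b' c'.
Proof. now intros -> -> ->. Qed.

Lemma jet_scal (N : nat) (k : C) (f : C -> C) (a b c : C) :
  (N <= 2)%nat -> jet N f a b c -> jet N (fun w => k * f w)%C (k * a) (k * b) (k * c).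
Proof.
intros HN H.
apply jet_ext with (4 := jet_mult _ _ _ _ _ _ _ _ _ HN (jet_const N k) H); ring.
Qed.

Lemma jet_psum_scale (N : nat) (b : nat -> R) (k : C) :
  (1 <= N <= 2)%nat -> (forall n, Rabs (b n) <= 1) -> disk k ->
  jet N (fun w => psum b (w * k)) (RtoC (b 0%nat)) (RtoC (b 1%nat) * k) (RtoC (b 2%nat) * k ^ 2).
Proof.
intros HN Hb Hk.
assert (HN2 : (N <= 2)%nat) by lia.
assert (Hg : jet N (fun w => w * k)%C 0 k 0).
{ apply jet_ext with (4 := jet_mult _ _ _ _ _ _ _ _ _ HN2 (jet_id N) (jet_const N k)); ring. }
assert (H := jet_comp_psum N b (1 / 2) (fun w => w * k)%C 0 k 0 HN Hb).
eapply jet_ext; [ | | | apply H; trivial]; rewrite ?psum_0; trivial.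
- unfold coef_deriv. simpl INR. rewrite RtoC_mult. replace (0 + 1) with 1 by ring. ring.
- unfold coef_deriv. simpl INR. replace (0 + 1) with 1 by ring. rewrite Rmult_1_l.
  replace (1 + 1) with 2 by ring.
  rewrite Cmult_0_r, Cplus_0_l, <- RtoC_mult. do 2 f_equal. field.
- lra.
- rewrite Cmod_0. lra.
- exists (1 / 2). split; [lra|]. intros w Hw. rewrite Cmod_mult.
  unfold disk in Hk. generalize (Cmod_ge_0 w) (Cmod_ge_0 k). nra.
Qed.

(** With [P] the proposed quadratic, [f g - P g] is [o(w ^ N)], and dividing by [g], bounded away
    from 0, keeps it so. The proposed coefficients are thus verified by multiplying out. *)
Lemma jet_divide (N : nat) (f g : C -> C) (a b c a' b' c' : C) (d : R) :
  (N <= 2)%nat -> 0 < d -> near0 (fun w => d <= Cmod (g w)) ->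
  jet N g a' b' c' ->
  jet N (fun w => f w * g w)%C (a * a') (a * b' + b * a') (a * c' + b * b' + c * a') ->
  jet N f a b c.
Proof.
intros HN Hd Hg Jg Jfg.
assert (JP := jet_mult _ _ _ _ _ _ _ _ _ HN (jet_quadratic N a b c) Jg).
set (P := fun w => (a + b * w + c * w ^ 2)%C).
assert (D : littleo N (fun w => f w * g w - P w * g w)%C).
{ apply littleo_near0 with (2 := jet_plus _ _ _ _ _ _ _ _ _ Jfg (jet_scal _ (- (1)) _ _ _ _ HN JP)).
  apply near0_true. intros w. unfold P. ring. }
assert (NZ : near0 (fun w => g w <> RtoC 0)).
{ revert Hg. apply near0_mono. intros w Hw. apply Cmod_gt_0. lra. }
apply littleo_near0 with (g := fun w => (/ g w * (f w * g w - P w * g w))%C).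
- revert NZ. apply near0_mono. intros w Hw. unfold P. field. exact Hw.
- apply littleo_mult with (/ d); trivial.
  generalize (near0_and _ _ NZ Hg). apply near0_mono. intros w [H1 H2].
  rewrite Cmod_inv by exact H1. now apply Rinv_le_contravar.
Qed.

Lemma jet_derive (f : C -> C) :
  ex_derive (K := C_AbsRing) (V := C_NormedModule) f (RtoC 0) ->
  jet 1 f (f 0%C) (C_derive f 0%C) 0.
Proof.
intros Hd. destruct (C_derive_correct f 0%C 0%C Hd) as [_ H].
intros eps He.
destruct (H (RtoC 0) (fun P HP => HP) (mkposreal eps He)) as [d Hb].
exists d. split; [apply cond_pos|]. intros w Hw.
assert (B : ball (M := AbsRing_UniformSpace C_AbsRing) (RtoC 0) d w).
{ change (Cmod (w - 0)%C < d). now replace (w - 0)%C with w by ring. }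
specialize (Hb w B). change (norm ?x) with (Cmod x) in Hb.
change (Cmod (f w - f 0 - (w - 0) * C_derive f 0)%C <= eps * Cmod (w - 0)%C) in Hb.
rewrite pow_1. replace (w - 0)%C with w in Hb by ring.
eapply Rle_trans; [ | exact Hb]. right. f_equal. ring.
Qed.

(** For fixed [z] both sides of the kernel identity are expanded in [w] at 0, and uniqueness of jets
    equates the coefficients of [w] and, if [N = 2], of [w ^ 2]. *)
Lemma kernel_identity_jet (N : nat) (phi : C -> C) (f1 f2 z : C) :
  (1 <= N <= 2)%nat ->
  (forall w, disk w -> disk (phi w)) -> disk z ->
  (forall w, disk w -> (psum kcoef (z * phi 0) * psum kcoef (w * phi z) =
     psum kcoef (w * phi 0) * psum kcoef (z * phi w))%C) ->
  jet N phi (phi 0%C) f1 f2 ->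
  let A := psum kcoef (z * phi 0)%C in
  let A1 := psum (coef_deriv kcoef) (z * phi 0)%C in
  let A2 := psum (coef_deriv (coef_deriv kcoef)) (z * phi 0)%C in
  let c n := RtoC (kcoef n) in
  (A * (c 1%nat * phi z) = c 0%nat * (A1 * (z * f1)) + c 1%nat * phi 0 * A)%C /\
  ((2 <= N)%nat ->
   (A * (c 2%nat * phi z ^ 2) =
    c 0%nat * (A1 * (z * f2) + RtoC (/ 2) * A2 * (z * f1) ^ 2)
    + c 1%nat * phi 0 * (A1 * (z * f1)) + c 2%nat * phi 0 ^ 2 * A)%C).
Proof.
intros HN Hphi Hz HF Jphi A A1 A2 c.
assert (HN2 : (N <= 2)%nat) by lia.
assert (Jl := jet_scal _ A _ _ _ _ HN2
  (jet_psum_scale N kcoef (phi z) HN kcoef_le (Hphi z Hz))).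
assert (Jr0 := jet_psum_scale N kcoef (phi 0) HN kcoef_le (Hphi _ disk_0)).
assert (Jr1 : jet N (fun w => psum kcoef (z * phi w)) A (A1 * (z * f1))
   (A1 * (z * f2) + RtoC (/ 2) * A2 * (z * f1) ^ 2)).
{ assert (Hr : 0 <= Cmod z < 1) by (split; [apply Cmod_ge_0 | exact Hz]).
  assert (Hle : forall w, disk w -> Cmod (z * phi w)%C <= (1 + Cmod z) / 2).
  { intros w Hw. rewrite Cmod_mult. assert (H := Hphi w Hw). unfold disk in H.
    generalize (Cmod_ge_0 (phi w)). nra. }
  (* The midpoint of [|z|] and 1 bounds [|z * phi w|], stays below 1, and is positive even for
     [z = 0]. *)
  apply jet_comp_psum with ((1 + Cmod z) / 2); trivial.
  - apply kcoef_le.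
  - lra.
  - apply Hle, disk_0.
  - exists 1. split; [lra|]. exact Hle.
  - now apply jet_scal. }
assert (Jr := jet_mult _ _ _ _ _ _ _ _ _ HN2 Jr0 Jr1).
assert (Jl' := jet_near0 N _ _ _ _ _ (ex_intro _ 1 (conj Rlt_0_1 HF)) Jr).
destruct (jet_unique _ _ _ _ _ _ _ _ Jl Jl') as [_ [H1 H2]].
unfold c. split; [rewrite H1 by lia | intros H3; rewrite H2 by exact H3]; ring.
Qed.

(** * The forms of [Psi] and [phi] *)

Lemma kernel_multiplier (Psi phi : C -> C) :
  (forall z w, disk z -> disk w ->
    (Psi z * psum kcoef (w * phi z) = Psi w * psum kcoef (z * phi w))%C) ->
  forall z, disk z -> Psi z = (32 * Psi 0 * psum kcoef (z * phi 0))%C.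
Proof.
intros HF z Hz. assert (H := HF z _ Hz disk_0).
rewrite Cmult_0_l, psum_0 in H.
replace (RtoC (kcoef 0)) with (/ RtoC 32)%C in H.
2:{ rewrite <- RtoC_inv by lra. f_equal. unfold kcoef. simpl. field. }
rewrite <- Cmult_assoc, <- H. field.
Qed.

Lemma kcoef_neq_0 (n : nat) : RtoC (kcoef n) <> RtoC 0.
Proof.
intros E. apply RtoC_inj in E. assert (H := weight_kcoef n). rewrite E in H. lra.
Qed.

Lemma symbol_form (phi : C -> C) (a1 z : C) :
  disk z -> disk (phi 0%C) ->
  (psum kcoef (z * phi 0) * (RtoC (kcoef 1) * phi z) =
    RtoC (kcoef 0) * (psum (coef_deriv kcoef) (z * phi 0) * (z * a1))
    + RtoC (kcoef 1) * phi 0 * psum kcoef (z * phi 0))%C ->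
  phi z = (phi 0 + a1 * (q_fun (phi 0) z / p_fun (phi 0) z))%C.
Proof.
intros Hz H0 E.
rewrite p_fun_psum, q_fun_psum by trivial.
rewrite (Cmult_comm (phi 0%C) z).
assert (HA := kernel_neq_0 _ (disk_mult _ _ Hz H0)).
set (A := psum kcoef _) in *. set (A1 := psum _ _) in *.
(* The prefactors of [q] and [p] are [c_0] and [c_1], so [q / p] is [c_0 / c_1] times [z k' / k], as
   the coefficient of [w] demands. *)
replace (RtoC (1 / 32)) with (RtoC (kcoef 0)) by (f_equal; unfold kcoef; simpl; field).
replace (RtoC (2 / 243)) with (RtoC (kcoef 1)) by (f_equal; unfold kcoef; simpl; field).
assert (H1 := kcoef_neq_0 1).
replace (phi z) with (A * (RtoC (kcoef 1) * phi z) / (A * RtoC (kcoef 1)))%C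
  by (field; now split).
rewrite E. field. now split.
Qed.

Lemma Cmult_cancel (k x y : C) : k <> RtoC 0 -> (k * x)%C = (k * y)%C -> x = y.
Proof.
intros Hk H. replace x with (/ k * (k * x))%C by (field; exact Hk).
rewrite H. field. exact Hk.
Qed.

(** By [kernel_multiplier] both sides of the kernel identity carry the factor [32 * Psi 0], which is
    nonzero unless [Psi] vanishes on the whole disk. Cancelling it leaves a relation in [phi]
    alone. *)
Lemma kernel_symmetry (Psi phi : C -> C) :
  (forall z, disk z -> disk (phi z)) -> W_complex_symmetric Psi phi ->
  (exists w, disk w /\ Psi w <> RtoC 0) ->
  forall z w, disk z -> disk w ->
  (psum kcoef (z * phi 0) * psum kcoef (w * phi z) =
   psum kcoef (w * phi 0) * psum kcoef (z * phi w))%C.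
Proof.
intros Hdisk HW [u [Hu Hu0]] z w Hz Hw.
assert (HF := complex_symmetric_kernel_identity _ _ Hdisk HW).
assert (HPsi := kernel_multiplier _ _ HF).
apply Cmult_cancel with (32 * Psi 0)%C.
- intros E. apply Hu0. rewrite (HPsi u Hu), E. ring.
- rewrite !Cmult_assoc, <- (HPsi z Hz), <- (HPsi w Hw). now apply HF.
Qed.

(** * Contradiction when [a0] and [a1] are both nonzero *)

Lemma Cminus_eq_0 (x y : C) : (x - y)%C = RtoC 0 -> x = y.
Proof. intros H. replace x with (x - y + y)%C by ring. rewrite H. ring. Qed.

(** Comparing the coefficients of [w ^ 2] in the kernel identity leaves an
    ordinary differential equation for the kernel along the ray of [a0]. *)
Lemma kernel_ode (phi : C -> C) (a1 : C) :
  let a0 := phi 0%C in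
  (forall w, disk w -> disk (phi w)) -> a1 <> RtoC 0 ->
  (forall w, disk w -> phi w = (a0 + a1 * (q_fun a0 w / p_fun a0 w))%C) ->
  (forall z w, disk z -> disk w ->
     (psum kcoef (z * a0) * psum kcoef (w * phi z) =
      psum kcoef (w * a0) * psum kcoef (z * phi w))%C) ->
  let c n := RtoC (kcoef n) in
  forall z, disk z -> z <> RtoC 0 ->
    (2 * c 2%nat * c 0%nat * psum (coef_deriv kcoef) (z * a0) ^ 2 =
     c 1%nat ^ 2 * psum kcoef (z * a0)
       * psum (coef_deriv (coef_deriv kcoef)) (z * a0))%C.
Proof.
intros a0 Hdisk Ha1 Hphi HF c z Hz Hz0.
assert (Ha0 : disk a0) by apply Hdisk, disk_0.
assert (H0 := kcoef_neq_0 0). assert (H1 := kcoef_neq_0 1).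
(* The coefficient of [w ^ 2] in [a0 + a1 * q / p], from [k = c_0 + c_1 a0 w + ...] and
   [k' = c_1 + 2 c_2 a0 w + ...] at [a0 w]. *)
set (f2 := (a1 * a0 * (2 * c 2%nat / c 1%nat - c 1%nat / c 0%nat))%C).
(* The formula for [phi] is cleared of its denominator, the form that [jet_divide] takes. *)
assert (Hsym : forall w, disk w -> (phi w * psum kcoef (w * a0) =
   a0 * psum kcoef (w * a0)
   + a1 * c 0%nat / c 1%nat * (w * psum (coef_deriv kcoef) (w * a0)))%C).
{ intros w Hw. rewrite (Hphi w Hw), p_fun_psum, q_fun_psum by trivial.
  rewrite (Cmult_comm a0 w).
  assert (HA := kernel_neq_0 _ (disk_mult _ _ Hw Ha0)).
  replace (RtoC (1 / 32)) with (c 0%nat) by (unfold c, kcoef; f_equal; simpl; field).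
  replace (RtoC (2 / 243)) with (c 1%nat) by (unfold c, kcoef; f_equal; simpl; field).
  unfold c. field. now split. }
assert (L : (1 <= 2 <= 2)%nat) by lia.
assert (Jk := jet_psum_scale 2 kcoef a0 L kcoef_le Ha0).
assert (Jk1 := jet_psum_scale 2 (coef_deriv kcoef) a0 L kcoef_deriv_le Ha0).
assert (Jphi : jet 2 phi a0 a1 f2).
{ apply jet_divide with
    (3 := near0_mono _ _ (fun w Hw => kernel_mod_bound _ (disk_mult _ _ Hw Ha0))
            (near0_lt 1 Rlt_0_1)) (4 := Jk);
    [lia | lra | ].
  apply jet_near0 with (1 := ex_intro _ 1 (conj Rlt_0_1 Hsym)).
  eapply jet_ext; [ | | | exact (jet_plus _ _ _ _ _ _ _ _ _ (jet_scal _ a0 _ _ _ _ (proj2 L) Jk)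
    (jet_scal _ (a1 * c 0%nat / c 1%nat) _ _ _ _ (proj2 L)
      (jet_mult _ _ _ _ _ _ _ _ _ (proj2 L) (jet_id 2) Jk1)))];
  unfold f2, c, coef_deriv; simpl INR; rewrite ?RtoC_mult, ?RtoC_plus; field;
  repeat split; assumption. }
destruct (kernel_identity_jet 2 phi a1 f2 z L Hdisk Hz (fun w Hw => HF z w Hz Hw) Jphi)
  as [E1 E2].
specialize (E2 (le_n 2)). fold a0 in E1, E2.
assert (HA := kernel_neq_0 _ (disk_mult _ _ Hz Ha0)).
set (A := psum kcoef (z * a0)) in *. set (A1 := psum (coef_deriv kcoef) _) in *.
set (A2 := psum (coef_deriv (coef_deriv kcoef)) _) in *.
fold (c 0%nat) (c 1%nat) (c 2%nat) in E1, E2, H0, H1.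
assert (Ep : phi z = (a0 + c 0%nat * A1 * z * a1 / (c 1%nat * A))%C).
{ replace (phi z) with (A * (c 1%nat * phi z) / (A * c 1%nat))%C by (field; now split).
  rewrite E1. field. now split. }
rewrite Ep in E2.
apply Cmult_cancel with (c 0%nat * (z * a1) ^ 2)%C.
- apply Cmult_neq_0; [exact H0 | now apply Cpow_nz, Cmult_neq_0].
(* The value of [f2] makes the terms linear in [a1] cancel; what remains of [E2], times
   [2 * c_1 ^ 2 * A], is the desired equation times [c_0 * (z * a1) ^ 2]. *)
- apply Cminus_eq_0.
  match type of E2 with ?l = ?r =>
    replace (RtoC 0) with (2 * c 1%nat ^ 2 * A * (l - r))%C by (rewrite E2; ring) end.
  unfold f2. rewrite (RtoC_inv 2) by lra. field. repeat split; assumption.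
Qed.

(** At [z = 0] both sides equal [2 c_0 c_1 ^ 2 c_2]. The equation therefore extends to the whole
    disk, but gives no contradiction at order 0, and the coefficient of [z] has to be compared. *)
Lemma kernel_ode_false (a0 : C) :
  disk a0 -> a0 <> RtoC 0 ->
  let c n := RtoC (kcoef n) in
  ~ (forall z, disk z -> z <> RtoC 0 ->
    (2 * c 2%nat * c 0%nat * psum (coef_deriv kcoef) (z * a0) ^ 2 =
     c 1%nat ^ 2 * psum kcoef (z * a0)
       * psum (coef_deriv (coef_deriv kcoef)) (z * a0))%C).
Proof.
intros Ha0 N0 c H.
assert (L : (1 <= 1 <= 2)%nat) by lia. assert (L2 : (1 <= 2)%nat) by lia.
assert (Jk := jet_psum_scale 1 kcoef a0 L kcoef_le Ha0).
assert (Jk1 := jet_psum_scale 1 _ a0 L kcoef_deriv_le Ha0).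
assert (Jk2 := jet_psum_scale 1 _ a0 L kcoef_deriv2_le Ha0).
assert (Jl := jet_scal _ (2 * c 2%nat * c 0%nat) _ _ _ _ L2
  (jet_mult _ _ _ _ _ _ _ _ _ L2 Jk1 Jk1)).
assert (Jr := jet_scal _ (c 1%nat ^ 2) _ _ _ _ L2 (jet_mult _ _ _ _ _ _ _ _ _ L2 Jk Jk2)).
assert (Hall : forall z, disk z ->
   (2 * c 2%nat * c 0%nat * (psum (coef_deriv kcoef) (z * a0) * psum (coef_deriv kcoef) (z * a0)) =
     c 1%nat ^ 2 * (psum kcoef (z * a0)
       * psum (coef_deriv (coef_deriv kcoef)) (z * a0)))%C).
{ intros z Hz. destruct (Ceq_dec z 0) as [E|N].
  - rewrite E, Cmult_0_l, !psum_0. unfold c, coef_deriv. simpl INR.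
    rewrite !RtoC_mult, !RtoC_plus. ring.
  - rewrite (Cmult_assoc (c 1%nat ^ 2)), <- (H z Hz N). ring. }
assert (Jl' := jet_near0 1 _ _ _ _ _ (ex_intro _ 1 (conj Rlt_0_1 Hall)) Jr).
destruct (jet_unique _ _ _ _ _ _ _ _ Jl Jl') as [_ [E _]].
specialize (E (le_n 1)). revert E. unfold c, coef_deriv. simpl INR. intros E.
apply (Cmult_cancel a0 (RtoC (8 * kcoef 0 * kcoef 1 * kcoef 2 ^ 2))
  (RtoC (2 * kcoef 1 ^ 3 * kcoef 2 + 6 * kcoef 0 * kcoef 1 ^ 2 * kcoef 3))) in N0.
(* The left side is [1 / (2 ^ 21 * 3 ^ 3)], the right side [1 / (2 ^ 6 * 3 ^ 14) + 1 / (3 ^ 9 * 5 ^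
   5)]; only one of the three terms has a denominator divisible by 5. *)
- apply RtoC_inj in N0. unfold kcoef in N0. simpl in N0. lra.
- rewrite !RtoC_mult, !RtoC_plus in E. rewrite !RtoC_plus, !RtoC_mult, !RtoC_pow.
  revert E. generalize (RtoC (kcoef 0)) (RtoC (kcoef 1)) (RtoC (kcoef 2)) (RtoC (kcoef 3)).
  intros x0 x1 x2 x3 E.
  match type of E with ?l = ?r => transitivity l; [ring | rewrite E; ring] end.
Qed.

(** If [Psi] is 0, the operator is 0 and is complex symmetric whatever [phi] is. Hence the formula
    for [phi] is asserted when [Psi] has a nonzero value, and the converse takes [a2 <> 0]. *)
Theorem theorem4p3 :
  (forall Psi phi : C -> C,
     holomorphic_on_disk Psi ->
     holomorphic_on_disk phi ->
     (forall z : C, disk z -> disk (phi z)) ->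
     W_complex_symmetric Psi phi ->
     let a0 := phi 0%C in
     let a1 := C_derive phi 0%C in
     let a2 := (3888 * Psi 0)%C in
     forall z : C, disk z ->
       ((exists w : C, disk w /\ Psi w <> 0%C) ->
          phi z = (a0 + a1 * (q_fun a0 z / p_fun a0 z))%C) /\
       Psi z = (a2 * p_fun a0 z)%C)
  /\
  (forall (a0 a1 a2 : C) (Psi phi : C -> C),
     disk a0 ->
     disk a1 ->
     a2 <> 0%C ->
     (forall z : C, disk z ->
        phi z = (a0 + a1 * (q_fun a0 z / p_fun a0 z))%C) ->
     (forall z : C, disk z -> Psi z = (a2 * p_fun a0 z)%C) ->
     holomorphic_on_disk phi ->
     holomorphic_on_disk Psi ->
     (forall z : C, disk z -> disk (phi z)) ->
     W_complex_symmetric Psi phi ->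
     a0 = 0%C \/ a1 = 0%C).
Proof.
split.
- intros Psi phi _ Hphi Hdisk HW a0 a1 a2 z Hz.
  split.
  + intros Hne.
    apply symbol_form; [exact Hz | apply Hdisk, disk_0 | ].
    (* Differentiability of [phi] at 0 gives a jet of order 1, in which the second-order coefficient
       is arbitrary; it is set to 0. *)
    apply (kernel_identity_jet 1 phi a1 0 z); [lia | exact Hdisk | exact Hz | | ].
    * intros w Hw. now apply (kernel_symmetry Psi).
    * apply jet_derive, Hphi, disk_0.
  + rewrite (kernel_multiplier Psi phi) by
      (trivial; now apply complex_symmetric_kernel_identity).
    (* The normalisation is [3888 * (2 / 243) = 32], the inverse of [c_0]. *)
    rewrite p_fun_psum. unfold a2, a0. rewrite (Cmult_comm (phi 0%C) z).
    rewrite RtoC_div by lra. field.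
- intros a0 a1 a2 Psi phi Ha0 _ Ha2 Hphi HPsi _ _ Hdisk HW.
  destruct (Ceq_dec a0 0) as [E0|N0]; [now left|].
  destruct (Ceq_dec a1 0) as [E1|N1]; [now right|]. exfalso.
  (* [q] vanishes at 0, so the parameter [a0] is the value of [phi] there. *)
  assert (Hphi0 : phi 0%C = a0).
  { rewrite (Hphi _ disk_0), q_fun_psum by (trivial; apply disk_0).
    unfold Cdiv. ring. }
  subst a0.
  apply (kernel_ode_false (phi 0%C) Ha0 N0), (kernel_ode phi a1); trivial.
  apply (kernel_symmetry Psi); trivial.
  (* [Psi 0] is [a2 * p_fun a0 0], nonzero since [k] has no zero in the disk. *)
  exists 0%C. split; [apply disk_0|].
  rewrite (HPsi _ disk_0), p_fun_psum.
  repeat apply Cmult_neq_0; trivial.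
  + intros E. apply RtoC_inj in E. lra.
  + apply kernel_neq_0. apply disk_mult; [exact Ha0 | apply disk_0].
Qed.
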